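(* Assume there is $L_m>0$ with $\|J(\mu,\cdot)-J(\nu,\cdot)\|_\infty\le L_mW_1(\mu,\nu)$ for all $\mu,\nu\in\mathcal P(\Omega)$, and there is $\alpha>0$ with $\langle J(\rho,\cdot)-J(\sigma,\cdot),\rho-\sigma\rangle\ge\alpha W_1(\rho,\sigma)^2$ for all $\rho,\sigma\in\mathcal P(\Omega)$. Let $X_h=\{x_1,\dots,x_{N_h}\}\subset\Omega$ be a finite set of $N_h\ge2$ distinct points, let $\delta_h:=\min_{i\ne j}|x_i-x_j|$, and let $0<\lambda<\frac1{L_mD_\Omega}$. Then the finite-mesh variational inequality admits a unique solution $\mu_h^\ast\in\mathcal P(X_h)$, characterized by $$\langle J(\mu_h^\ast,\cdot),\eta_h-\mu_h^\ast\rangle\ge0\qquad\forall\,\eta_h\in\mathcal P(X_h).$$ Let $(\mu_{k,h},\nu_{k,h})_{k\ge0}$ be the KL Mirror-Prox iterates with stepsize $\lambda$ initialized from $\mu_{0,h}\in\mathcal P(X_h)$, where $\mu_{0,h}$ has full support on $X_h$. Then $W_1(\mu_{k,h},\mu_h^\ast)\to0$ and $W_1(\nu_{k,h},\mu_h^\ast)\to0$ as $k\to\infty$. Define $D_{k,h}:=D_{\rm KL}(\mu_h^\ast\|\mu_{k,h})$, $m_h^\ast:=\min_{x\in\operatorname{supp}\mu_h^\ast}\mu_h^\ast(x)$, and $$\beta:=\frac12\min\left\{\lambda\alpha,\frac{1-\lambda L_mD_\Omega}{2D_\Omega^2}\right\},\qquad \gamma_h:=\frac14\min\left\{\frac{\lambda\alpha\delta_h^2}{2},\,1-\lambda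 L_mD_\Omega\right\}.$$ Then the following hold. (1) For every $k\ge0$, $\ \beta\,W_1(\mu_{k,h},\mu_h^\ast)^2\le D_{k,h}-D_{k+1,h}$. (2) There exists $k_{0,h}\in\mathbb N$ with $k_{0,h}\le\left\lceil\frac{256D_{0,h}}{\gamma_h(m_h^\ast)^4}\right\rceil$ such that, for every $k\ge k_{0,h}$, $$D_{k,h}\le\frac{1}{\frac{8}{(m_h^\ast)^2}+\frac{\gamma_h}{4}(k-k_{0,h})}\quad\text{and}\quad W_1(\mu_{k,h},\mu_h^\ast)\le D_\Omega\sqrt{\frac{2}{\frac{8}{(m_h^\ast)^2}+\frac{\gamma_h}{4}(k-k_{0,h})}}.$$ (3) If, in addition, $\mu_h^\ast$ has full support on $X_h$, then there exists $k_{0,h}\in\mathbb N$ with $k_{0,h}\le\left\lceil\frac{8D_{0,h}}{\gamma_h(m_h^\ast)^3}\right\rceil$ such that, for every $k\ge k_{0,h}$, $$D_{k,h}\le\frac{(m_h^\ast)^2}{8}(1-\gamma_hm_h^\ast)^{k-k_{0,h}}\quad\text{and}\quad W_1(\mu_{k,h},\mu_h^\ast)\le D_\Omega\frac{m_h^\ast}{2}(1-\gamma_hm_h^\ast)^{(k-k_{0,h})/2}.$$ Finally, $$D_{0,h}\le-\log\Bigl(\min_{x\in\operatorname{supp}\mu_h^\ast}\mu_{0,h}(x)\Bigr)\le-\log\Bigl(\min_{x\in X_h}\mu_{0,h}(x)\Bigr).$$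
   Context: $\Omega\subset\mathbb R^d$ is a nonempty compact set, $D_\Omega:=\sup_{x,y\in\Omega}|x-y|$, and $\mathcal P(\Omega)$ is the set of Borel probability measures on $\Omega$. $J:\mathcal P(\Omega)\times\Omega\to\mathbb R$ is such that $J(\mu,\cdot)\in C(\Omega)$ for every $\mu\in\mathcal P(\Omega)$. For $f\in C(\Omega)$ and a finite signed measure $\xi$, $\langle f,\xi\rangle:=\int_\Omega f\,d\xi$. $W_1$ is the 1-Wasserstein distance on $\mathcal P(\Omega)$ for the Euclidean distance. $D_{\rm KL}(\eta\|\mu):=\int\log\frac{d\eta}{d\mu}\,d\eta$ if $\eta\ll\mu$ and $+\infty$ otherwise. $\mathcal P(X_h)$ is identified with the set of measures in $\mathcal P(\Omega)$ supported on $X_h$; for $\mu\in\mathcal P(X_h)$, $\mu(x):=\mu(\{x\})$; $\mathbb N$ includes $0$. KL Mirror-Prox iterates with stepsize $\lambda>0$ initialized from $\mu_{0,h}\in\mathcal P(X_h)$: for $k=0,1,2,\dots$ and $x\in X_h$, $$\nu_{k,h}(x)=\frac{\mu_{k,h}(x)e^{-\lambda J(\mu_{k,h},x)}}{\sum_{y\in X_h}\mu_{k,h}(y)e^{-\lambda J(\mu_{k,h},y)}},\qquad \mu_{k+1,h}(x)=\frac{\mu_{k,h}(x)e^{-\lambda J(\nu_{k,h},x)}}{\sum_{y\in X_h}\mu_{k,h}(y)e^{-\lambda J(\nu_{k,h},y)}}.$$ *)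

(* Defs.v *)
From mathcomp Require Export all_boot all_order all_algebra.
From mathcomp Require Export all_classical all_reals all_analysis.
Export Order.TTheory GRing.Theory Num.Theory numFieldNormedType.Exports.

Set Implicit Arguments.
Unset Strict Implicit.
Unset Printing Implicit Defensive.

Local Open Scope classical_set_scope.
Local Open Scope ring_scope.

(* R^d with its Borel sigma-algebra; the underlying type is 'rV[R]_d, whose
   product topology is the Euclidean one *)
Notation borel R d := (g_sigma_algebraType (@open 'rV[R]_d)).

Section Euclidean.
Variables (R : realType) (d : nat).
Implicit Types x y : 'rV[R]_d.

(* the library norm on 'rV[R]_d is the sup norm, hence this definition *)
Definition edist x y : R := Num.sqrt (\sum_(i < d) (x 0 i - y 0 i) ^+ 2).

Definition diam (Omega : set 'rV[R]_d) : R :=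
  sup [set edist p.1 p.2 | p in Omega `*` Omega].

(* minimum over a finite nonempty set when n >= 2 *)
Definition separation (n : nat) (X : 'I_n -> 'rV[R]_d) : R :=
  inf [set edist (X p.1) (X p.2) | p in [set p : 'I_n * 'I_n | p.1 != p.2]].

Definition sup_norm (Omega : set 'rV[R]_d) (f : 'rV[R]_d -> R) : R :=
  sup [set `|f x| | x in Omega].

End Euclidean.

Section Measures.
Variables (R : realType) (d : nat).
Local Notation T := (borel R d).
Implicit Types (mu nu eta rho sigma : probability T R) (f : 'rV[R]_d -> R).

(* mu \in P(A), for A a Borel set *)
Definition prob_on (A : set 'rV[R]_d) mu : Prop := mu A = 1%E.

(* Library measures are functions on all sets, constrained only on measurable
   ones; two of them represent the same measure when they agree on the latter *)
Definition same_measure mu nu : Prop :=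
  forall A : set T, measurable A -> mu A = nu A.

Definition mass mu (x : 'rV[R]_d) : R := fine (mu [set x]).

Definition supp mu : set 'rV[R]_d :=
  [set x | forall U : set 'rV[R]_d, open U -> U x -> (0 < mu U)%E].

(* <f, rho - sigma> *)
Definition pairing (Omega : set 'rV[R]_d) f rho sigma : R :=
  \int[rho]_(x in Omega) f x - \int[sigma]_(x in Omega) f x.

Definition coupling mu nu : set (probability (T * T)%type R) :=
  [set pi | (forall A : set T, measurable A -> pi (A `*` setT) = mu A) /\
            (forall B : set T, measurable B -> pi (setT `*` B) = nu B)].

(* the infimum is finite for measures on a bounded set *)
Definition W1 mu nu : R :=
  fine (ereal_inf [set (\int[pi]_p (edist p.1 p.2)%:E)%E | pi in coupling mu nu]).

Local Open Scope charge_scope.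

Definition KL eta mu : \bar R :=
  if `[< eta `<< mu >]
  then (\int[eta]_x lne (('d (charge_of_finite_measure eta) '/d mu) x))%E
  else +oo%E.

End Measures.

Section MirrorProx.
Variables (R : realType) (d n : nat).
Local Notation T := (borel R d).
Variable J : probability T R -> 'rV[R]_d -> R.
Variable X : 'I_n -> 'rV[R]_d.
Implicit Types (mu nu : probability T R).

(* J is only meant on P(Omega) x Omega; its other values are irrelevant *)
Definition solves_VI (Omega : set 'rV[R]_d) mu : Prop :=
  prob_on (range X) mu /\
  forall eta, prob_on (range X) eta -> 0 <= pairing Omega (J mu) eta mu.

(* a measure in P(X_h) is determined by its masses at the X i, so this fixes
   nu up to same_measure *)
Definition KL_step (lam : R) mu (f : 'rV[R]_d -> R) nu : Prop :=
  prob_on (range X) nu /\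
  forall i, mass nu (X i) =
    mass mu (X i) * expR (- lam * f (X i)) /
    \sum_j mass mu (X j) * expR (- lam * f (X j)).

Definition KL_mirror_prox (lam : R) (mu nu : nat -> probability T R) : Prop :=
  prob_on (range X) (mu 0%N) /\
  forall k, KL_step lam (mu k) (J (mu k)) (nu k) /\
            KL_step lam (mu k) (J (nu k)) (mu k.+1).

End MirrorProx.

(* Main.v *)
Require Import Defs.
From mathcomp Require Import all_boot all_order all_algebra.
From mathcomp Require Import all_classical all_reals all_analysis.
From mathcomp Require Import measurable_realfun.
From mathcomp Require Import ring lra.

(** Everything happens on the simplex of mass vectors on the mesh.  There the
    theorem is the convergence analysis of the extragradient method with the
    entropy as mirror map, with [W1] replacing the norm on the primal side.

    Descent.  The three-point identity of a Gibbs step ([three_point]), used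
    once for the prediction [nu k] and once for the correction [mu k.+1], turns
    the decrease of the Kullback-Leibler gap [D k] into the monotonicity gain
    [lam * alpha * W1 (nu k) mus ^+ 2], plus the divergences of the two half
    steps, minus the error of having evaluated [J] at [mu k] instead of
    [nu k].  Since [W1] is at most [diam Omega] times the total variation, the
    error is absorbed by the divergences through Pinsker's inequality as soon as
    [lam * L * diam Omega < 1] ([mirror_prox_energy], [gap_decrease]).

    From descent to rates.  [W1] is at least [separation X] times the total
    variation, so the decrease of [D] controls the squared l1 distance from
    [mu k] to the solution ([gap_l1]).  Conversely, once the l1 distance is
    below half of the smallest mass [m] of the solution, [D] is at most twice
    this distance ([kl_le_l1]), and at most its square over [m] when the
    solution charges the whole mesh ([kl_le_l1_sqr]); in general, mass put where
    the solution vanishes enters the divergence linearly.  Hence locally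
    [D k - D k.+1] is at least a multiple of [D k ^+ 2], respectively of [D k],
    and this gives the two rates.  Far from the solution the decrease is
    bounded below, so the local regime is entered after a number of steps
    proportional to the initial gap ([first_passage]).

    Well-posedness.  On the simplex [J] is Lipschitz and strongly monotone, so
    a short projected step is a strict contraction, and by compactness some
    point minimizes the distance to its image: it is fixed, hence a solution
    ([VI_solution_exists]).  Strong monotonicity gives uniqueness.

    The link with measures is that an integral against a measure carried by
    finitely many atoms is a finite sum ([integral_atoms]).  It makes couplings
    into transport plans, i.e. matrices with given marginals, and the
    divergence [KL] into a finite sum. *)

Set Implicit Arguments.
Unset Strict Implicit.
Unset Printing Implicit Defensive.

Local Open Scope classical_set_scope.
Local Open Scope ring_scope.

(* the real-valued Euclidean distance, as against the extended-real metric of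
   the same name *)
Local Notation edist := Defs.edist.

(** * A lower bound on the logarithm *)

Section LogBound.
Variable R : realType.

(** The rational function that agrees with the logarithm at 1 up to order three,
    whence the cube in the derivative of their difference. *)
Definition ln_minorant (t : R) : R := (t - 1) * (5 * t + 1) / (2 * t * (t + 2)).

Lemma is_derive_ln_gap (t : R) : 0 < t ->
  is_derive t 1 (fun x => ln x - ln_minorant x) ((t - 1) ^+ 3 / (t ^+ 2 * (t + 2) ^+ 2)).
Proof.
move=> t0.
have tn0 : 2 * t * (t + 2) != 0 by rewrite gt_eqF// !mulr_gt0// addr_gt0.
have d1 := is_derive1_ln t0.
have dn : is_derive t (1:R) (fun x : R => (x - 1) * (5 * x + 1)) (10 * t - 4).
  apply: is_derive_eq.
  rewrite /GRing.scale /=; ring.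
have dd : is_derive t (1:R) (fun x : R => 2 * x * (x + 2)) (4 * t + 4).
  apply: is_derive_eq.
  rewrite /GRing.scale /=; ring.
have di := @is_deriveV R (fun x : R => 2 * x * (x + 2)) t _ 1 tn0 dd.
have dm := is_deriveM dn di.
have dB := is_deriveB d1 dm.
apply: (is_derive_eq dB).
rewrite /GRing.scale /=.
field.
by rewrite !gt_eqF// addr_gt0.
Qed.

(** The derivative of the difference has the sign of [t - 1]. *)
Lemma ln_ge_minorant (t : R) : 0 < t -> ln_minorant t <= ln t.
Proof.
move=> t0; rewrite -subr_ge0.
pose h := fun x : R => ln x - ln_minorant x.
have h1 : h 1 = 0 by rewrite /h ln1 /ln_minorant subrr !mul0r subrr.
rewrite -/(h t).
have hc (a b : R) : 0 < a -> {within `[a, b], continuous h}.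
  move=> a0; apply: derivable_within_continuous => x; rewrite in_itv/= => /andP[ax _].
  by have [] := is_derive_ln_gap (lt_le_trans a0 ax).
have den (c : R) : 0 < c -> 0 < c ^+ 2 * (c + 2) ^+ 2.
  by move=> c0; rewrite mulr_gt0// exprn_gt0// addr_gt0.
have [t1|t1|->] := ltgtP t 1; last by rewrite h1.
- have dh x : x \in `]t, 1[ -> is_derive x 1 h ((x - 1) ^+ 3 / (x ^+ 2 * (x + 2) ^+ 2)).
    by rewrite in_itv/= => /andP[tx _]; exact: is_derive_ln_gap (lt_trans t0 tx).
  have [c] := MVT t1 dh (hc _ _ t0).
  rewrite in_itv/= h1 => /andP[tc c1] E.
  have : h t = - ((c - 1) ^+ 3 / (c ^+ 2 * (c + 2) ^+ 2) * (1 - t)) by rewrite -E; ring.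
  move=> ->; rewrite -mulNr mulr_ge0 ?subr_ge0 ?(ltW t1)//.
  rewrite -mulNr; apply: divr_ge0; last by rewrite ltW// den// (lt_trans t0).
  by rewrite -oppr_le0 opprK ltW// exprn_odd_lt0//= subr_lt0.
- have dh x : x \in `]1, t[ -> is_derive x 1 h ((x - 1) ^+ 3 / (x ^+ 2 * (x + 2) ^+ 2)).
    by rewrite in_itv/= => /andP[tx _]; exact: is_derive_ln_gap (lt_trans ltr01 tx).
  have [c] := MVT t1 dh (hc _ _ ltr01).
  rewrite in_itv/= h1 subr0 => /andP[c1 tc] ->.
  rewrite mulr_ge0 ?subr_ge0 ?(ltW t1)//.
  apply: divr_ge0; last by rewrite ltW// den// (lt_trans ltr01).
  by rewrite exprn_ge0// subr_ge0 ltW.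
Qed.

End LogBound.

(** * Probability vectors and relative entropy *)

Section FiniteDistributions.
Variables (R : realType) (n : nat).
Implicit Types p q v u : 'I_n -> R.

Definition distr p : Prop := (forall i, 0 <= p i) /\ \sum_i p i = 1.

Definition l1 p q : R := \sum_i `|p i - q i|.

Definition kl q p : R := \sum_i q i * ln (q i / p i).

Lemma l1_ge0 p q : 0 <= l1 p q.
Proof. by apply: sumr_ge0 => i _. Qed.

Lemma l1C p q : l1 p q = l1 q p.
Proof. by apply: eq_bigr => i _; rewrite distrC. Qed.

Lemma l1_triangle p v q : l1 p q <= l1 p v + l1 v q.
Proof.
rewrite -big_split; apply: ler_sum => i _ /=.
by rewrite (le_trans _ (ler_normD _ _))// addrA subrK.
Qed.

Lemma distr_le1 p i : distr p -> p i <= 1.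
Proof. by case=> p0 <-; rewrite (bigD1 i)//= lerDl sumr_ge0. Qed.

(** Pinsker's inequality, one term at a time.  The logarithmic bound gives
    [3 * (a - b) ^+ 2 / w] with [w = 2 * a + 4 * b]; completing the square in [s]
    makes it linear in the weight [w], and ready for summation. *)
Lemma kl_term_ge (a b s : R) : 0 <= a -> 0 < b ->
  3 * (2 * s * `|a - b| - s ^+ 2 * (2 * a + 4 * b)) <= a * ln (a / b) - a + b.
Proof.
move=> a0 b0.
have w0 : 0 < 2 * a + 4 * b by rewrite ltr_wpDl ?mulr_ge0 ?mulr_gt0.
apply: (@le_trans _ _ (3 * (a - b) ^+ 2 / (2 * a + 4 * b))).
  rewrite -[leRHS]mulrA ler_pM2l// ler_pdivlMr// -[(a - b) ^+ 2]real_normK ?num_real//.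
  have := sqr_ge0 (`|a - b| - s * (2 * a + 4 * b)); nra.
have [a00|a00] := eqVneq a 0.
  rewrite a00 !mul0r !mulr0 !add0r sqrrN oppr0 add0r.
  rewrite ler_pdivrMr ?mulr_gt0//; have := sqr_ge0 b; nra.
have {a00}a0 : 0 < a by rewrite lt_neqAle eq_sym a00.
have t0 : 0 < a / b by rewrite divr_gt0.
have := ln_ge_minorant t0; rewrite -(ler_pM2l a0) => /le_trans - /(_ _ (lexx _)) H.
apply: (@le_trans _ _ (a * ln_minorant (a / b) - a + b)); last by lra.
rewrite /ln_minorant le_eqVlt; apply/orP; left; apply/eqP; field.
by rewrite !gt_eqF//; lra.
Qed.

Lemma pinsker q p : distr q -> distr p -> (forall i, 0 < p i) ->
  l1 q p ^+ 2 <= 2 * kl q p.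
Proof.
move=> [q0 q1] [_ p1] p0.
(* the weights [2 * q i + 4 * p i] add up to 6 *)
pose s := l1 q p / 6.
have : \sum_i 3 * (2 * s * `|q i - p i| - s ^+ 2 * (2 * q i + 4 * p i)) <=
       \sum_i (q i * ln (q i / p i) - q i + p i).
  by apply: ler_sum => i _; exact: kl_term_ge.
rewrite -mulr_sumr sumrB -!mulr_sumr !big_split /= sumrN -!mulr_sumr q1 p1.
by rewrite -/(l1 q p) -/(kl q p) /s; nra.
Qed.

Lemma kl_ge0 q p : distr q -> distr p -> (forall i, 0 < p i) -> 0 <= kl q p.
Proof.
by move=> dq dp p0; have := pinsker dq dp p0; have := sqr_ge0 (l1 q p); lra.
Qed.


Definition gibbs_step (lam : R) p (f : 'I_n -> R) : 'I_n -> R := fun i =>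
  p i * expR (- lam * f i) / \sum_j p j * expR (- lam * f j).

Section GibbsStep.
Variables (lam : R) (p f : 'I_n -> R).
Hypotheses (dp : distr p) (p_gt0 : forall i, 0 < p i).

Let Z := \sum_j p j * expR (- lam * f j).

Let Z_gt0 : 0 < Z.
Proof.
rewrite lt_neqAle eq_sym psumr_neq0 => [|j _]; last by rewrite mulr_ge0 ?expR_ge0 ?ltW.
rewrite sumr_ge0 ?andbT => [|j _]; last by rewrite mulr_ge0 ?expR_ge0 ?ltW.
have : \sum_j p j != 0 by rewrite dp.2 oner_neq0.
rewrite psumr_neq0 => [|j _]; last exact: ltW.
move=> /hasP[j js _]; apply/hasP; exists j => //=.
by rewrite mulr_gt0 ?expR_gt0.
Qed.

Lemma gibbs_step_gt0 i : 0 < gibbs_step lam p f i.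
Proof. by rewrite /gibbs_step !mulr_gt0 ?expR_gt0 ?invr_gt0. Qed.

Lemma gibbs_step_distr : distr (gibbs_step lam p f).
Proof.
split=> [i|]; first exact/ltW/gibbs_step_gt0.
by rewrite -mulr_suml divff// gt_eqF.
Qed.

Let kl_gibbs u : distr u ->
  kl u p - kl u (gibbs_step lam p f) = - lam * (\sum_i u i * f i) - ln Z.
Proof.
move=> [u0 u1].
rewrite -sumrB mulr_sumr -[ln Z]mul1r -u1 mulr_suml -sumrB.
apply: eq_bigr => i _.
have [->|uin0] := eqVneq (u i) 0; first by rewrite !mul0r mulr0 !subrr.
have ui : 0 < u i by rewrite lt_neqAle eq_sym uin0 u0.
have -> : gibbs_step lam p f i = p i * expR (- lam * f i) / Z by [].
rewrite !ln_div ?posrE ?divr_gt0 ?mulr_gt0 ?expR_gt0//.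
rewrite lnM ?posrE ?expR_gt0// expRK; ring.
Qed.

(** Up to a normalization that does not depend on [u], [kl u p - kl u v] is linear
    in [u] when [v] is a Gibbs step from [p]; the right-hand side is what remains
    after subtracting the same identity at [u = v]. *)
Lemma three_point u : distr u ->
  kl u p - kl u (gibbs_step lam p f) - kl (gibbs_step lam p f) p =
  lam * \sum_i f i * (gibbs_step lam p f i - u i).
Proof.
move=> du; set v := gibbs_step lam p f.
have klvv : kl v v = 0.
  by apply: big1 => i _; rewrite divff ?gt_eqF ?gibbs_step_gt0// ln1 mulr0.
have := kl_gibbs gibbs_step_distr; rewrite -/v klvv subr0 => ->.
rewrite (kl_gibbs du).
have -> : \sum_i f i * (v i - u i) = \sum_i v i * f i - \sum_i u i * f i.
  by rewrite -sumrB; apply: eq_bigr => i _; ring.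
by ring.
Qed.

End GibbsStep.

(** The gain [a] comes from the direction [g] evaluated at the predicted point [v].
    The mismatch between [g] and the direction [f] used to predict costs
    [lam * K * l1 p v * l1 p' v], which Pinsker's inequality bounds by [lam * K]
    times the sum of the two divergences that the three-point identities release. *)
Lemma mirror_prox_energy (lam K a : R) p q f g :
  distr p -> (forall i, 0 < p i) -> distr q -> 0 <= lam -> 0 <= K ->
  let v := gibbs_step lam p f in let p' := gibbs_step lam p g in
  (forall i, `|f i - g i| <= K * l1 p v) -> lam * K <= 1 ->
  a <= \sum_i g i * (v i - q i) ->
  lam * a + (1 - lam * K) * kl v p <= kl q p - kl q p'.
Proof.
move=> dp p0 dq lam0 K0 v p' fg lamK aq.
have dv : distr v := gibbs_step_distr lam f dp p0.
have dp' : distr p' := gibbs_step_distr lam g dp p0.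
have v0 : forall i, 0 < v i := gibbs_step_gt0 lam f dp p0.
have E1 := three_point lam g dp p0 dq; rewrite -/p' in E1.
have E2 := three_point lam f dp p0 dp'; rewrite -/v in E2.
have Eg : \sum_i g i * (p' i - q i) =
    \sum_i g i * (p' i - v i) + \sum_i g i * (v i - q i).
  by rewrite -big_split; apply: eq_bigr => i _ /=; ring.
have Efg : `|\sum_i f i * (v i - p' i) + \sum_i g i * (p' i - v i)| <=
    K * l1 p v * l1 p' v.
  rewrite -big_split /= [leRHS]mulr_sumr (le_trans (ler_norm_sum _ _ _))//.
  apply: ler_sum => i _.
  have -> : f i * (v i - p' i) + g i * (p' i - v i) =
            - ((f i - g i) * (p' i - v i)) by ring.
  by rewrite normrN normrM ler_wpM2r.
have P1 := pinsker dv dp p0.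
have P2 := pinsker dp' dv v0.
rewrite (l1C v) in P1.
have amgm : l1 p v * l1 p' v <= kl v p + kl p' v.
  by have := sqr_ge0 (l1 p v - l1 p' v); nra.
have X : K * l1 p v * l1 p' v <= K * (kl v p + kl p' v).
  by rewrite -mulrA ler_wpM2l.
have {Efg X} := le_trans Efg X; rewrite ler_norml => /andP[+ _] => lo.
have kl0 := kl_ge0 dp' dv v0.
have := ler_wpM2l lam0 lo; have := ler_wpM2l lam0 aq.
have : 0 <= (1 - lam * K) * kl p' v by rewrite mulr_ge0// subr_ge0.
rewrite Eg in E1; lra.
Qed.

(** The positive and negative parts of a difference of probability vectors have
    the same sum. *)
Lemma dist_le_half_l1 p q i : distr p -> distr q -> 2 * `|p i - q i| <= l1 p q.
Proof.
move=> [_ p1] [_ q1]; rewrite /l1 (bigD1 i)//= mulr2n mulrDl mul1r lerD2l.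
have : \sum_j (p j - q j) = 0 by rewrite sumrB p1 q1 subrr.
rewrite (bigD1 i)//= => /eqP; rewrite addr_eq0 => /eqP ->.
by rewrite normrN; exact: ler_norm_sum.
Qed.

Lemma ln_div_le (a b : R) : 0 <= a -> 0 < b -> a * ln (a / b) <= a * (a - b) / b.
Proof.
move=> a0 b0; have [->|an0] := eqVneq a 0; first by rewrite !mul0r.
have {an0 a0}a0 : 0 < a by rewrite lt_neqAle eq_sym an0.
rewrite -mulrA ler_pM2l// mulrBl divff ?gt_eqF//.
have := @le_ln1Dx R (a / b - 1).
have -> : 1 + (a / b - 1) = a / b by ring.
by apply; rewrite ltrBDr addNr divr_gt0.
Qed.

Section NearSolution.
Variables (m : R) (p q : 'I_n -> R).
Hypotheses (m_gt0 : 0 < m) (dq : distr q) (dp : distr p).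
Hypotheses (p_gt0 : forall i, 0 < p i) (close : l1 q p <= m / 2).

Let dist_le i : `|q i - p i| <= m / 2.
Proof.
have := dist_le_half_l1 i dq dp; have := normr_ge0 (q i - p i).
by move: m_gt0 close; lra.
Qed.

(** Where [q] charges, [p] is at least half of [q], so the logarithm is linear up to
    a factor 2; where [q] vanishes the relative entropy has no term. *)
Lemma kl_le_l1 : (forall i, 0 < q i -> m <= q i) -> kl q p <= 2 * l1 q p.
Proof.
move=> mq; rewrite mulr_sumr; apply: ler_sum => i _.
have [q0|qn0] := eqVneq (q i) 0; first by rewrite q0 mul0r mulr_ge0.
have {qn0}q0 : 0 < q i by rewrite lt_neqAle eq_sym qn0 (dq.1 i).
apply: le_trans (ln_div_le (ltW q0) (p_gt0 i)) _.
have half : q i <= 2 * p i.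
  by have := mq i q0; have := dist_le i; rewrite ler_norml => /andP[? ?]; lra.
rewrite ler_pdivrMr//; apply: (@le_trans _ _ (q i * `|q i - p i|)).
  by rewrite ler_wpM2l ?ler_norm ?ltW.
by rewrite mulrAC ler_wpM2r.
Qed.

(** Relative entropy is at most the chi-square divergence, that is
    [\sum_i (q i - p i) ^+ 2 / p i], where [p i] is at least [m / 2] and one factor
    [`|q i - p i|] is at most half of the l1 distance. *)
Lemma kl_le_l1_sqr : (forall i, m <= q i) -> m * kl q p <= l1 q p ^+ 2.
Proof.
move=> mq; rewrite mulr_sumr.
have -> : l1 q p ^+ 2 = \sum_i (l1 q p * `|q i - p i| + m * (q i - p i)).
  (* the added linear terms cancel, and turn the entropy into chi-square *)
  by rewrite big_split /= -!mulr_sumr sumrB dq.2 dp.2 subrr mulr0 addr0 expr2.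
apply: ler_sum => i _.
have q0 : 0 <= q i by exact: dq.1.
apply: (@le_trans _ _ (m * (q i * (q i - p i) / p i))).
  by rewrite ler_pM2l// ln_div_le.
have -> : m * (q i * (q i - p i) / p i) =
    (m / p i * `|q i - p i|) * `|q i - p i| + m * (q i - p i).
  rewrite -(mulrA (m / p i)) -expr2 real_normK ?num_real//; field.
  by rewrite gt_eqF.
rewrite lerD2r ler_wpM2r//.
apply: le_trans (dist_le_half_l1 i dq dp); rewrite ler_wpM2r//.
have := dist_le i; have := mq i; rewrite ler_pdivrMr// ler_norml => ? /andP[? ?].
by lra.
Qed.

End NearSolution.

End FiniteDistributions.

(** * Rates of decrease of real sequences *)

Section Rates.
Variable R : realType.
Implicit Types (D : nat -> R).

(** While the sequence stays above [b] it loses [c] at each step, and it cannot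
    become negative. *)
Lemma first_passage D (b c : R) : (forall k, 0 <= D k) -> 0 <= b -> 0 < c ->
  (forall k, b < D k -> c <= D k - D k.+1) ->
  exists2 k0 : nat, k0%:Z <= Num.ceil (D 0%N / c) & D k0 <= b.
Proof.
move=> D0 b0 c0 step.
pose K := `|Num.ceil (D 0%N / c)|%N.
have ceil_ge0 : 0 <= Num.ceil (D 0%N / c).
  by rewrite -(ler_int R) (le_trans _ (ceil_ge _))// divr_ge0// ltW.
have KE : K%:Z = Num.ceil (D 0%N / c) by rewrite gez0_abs.
apply: contrapT => none.
have far k : (k <= K)%N -> b < D k.
  move=> kK; rewrite ltNge; apply/negP => Dk; apply: none; exists k => //.
  by rewrite -KE lez_nat.
have dec k : (k <= K)%N -> D k <= D 0%N - k%:R * c.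
  elim: k => [|k IH] kK; first by rewrite mul0r subr0.
  have := step k (far k (ltnW kK)); have := IH (ltnW kK).
  by rewrite -natr1 mulrDl mul1r; lra.
have := lt_le_trans (le_lt_trans b0 (far K (leqnn K))) (dec K (leqnn K)).
rewrite subr_gt0 -ltr_pdivlMr// ltNge => /negP; apply.
by have := ceil_ge (D 0%N / c); rewrite -KE.
Qed.

Lemma linear_rate D (b r : R) k0 : 0 <= r -> D k0 <= b ->
  (forall k, (k0 <= k)%N -> D k.+1 <= r * D k) ->
  forall k, (k0 <= k)%N -> D k <= b * r ^+ (k - k0).
Proof.
move=> r0 Db step k /subnKC <-; rewrite addKn.
elim: (k - k0)%N => [|j IH]; first by rewrite addn0 expr0 mulr1.
rewrite addnS (le_trans (step _ _)) ?leq_addr//.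
by rewrite exprS mulrCA ler_wpM2l.
Qed.

(** The inverse of the sequence grows by at least [c] at each step. *)
Lemma sublinear_rate D (a c : R) k0 : 0 < a -> 0 <= c -> (forall k, 0 <= D k) ->
  D k0 <= 1 / a -> (forall k, (k0 <= k)%N -> c * D k ^+ 2 <= D k - D k.+1) ->
  forall k, (k0 <= k)%N -> D k <= 1 / (a + c * (k - k0)%:R).
Proof.
move=> a0 c0 D0 Da step k /subnKC <-; rewrite addKn.
elim: (k - k0)%N => [|j IH]; first by rewrite addn0 mulr0 addr0.
rewrite addnS; move: (step (k0 + j)%N (leq_addr _ _)) (D0 (k0 + j).+1) (D0 (k0 + j)%N) IH.
set x := D (k0 + j)%N; set y := D _ => xy y0 x0.
set A := a + c * j%:R.
have A0 : 0 < A by rewrite ltr_wpDr// mulr_ge0.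
have -> : a + c * j.+1%:R = A + c by rewrite -natr1 /A; ring.
rewrite !ler_pdivlMr ?(ltr_wpDl _ A0)// => [xA|]; last by rewrite ltr_wpDr.
have [x00|xn0] := eqVneq x 0.
  have -> : y = 0 by move: xy; rewrite x00 expr0n mulr0 sub0r; lra.
  by rewrite mul0r.
have {xn0 x0}x0 : 0 < x by rewrite lt_neqAle eq_sym xn0.
rewrite -(ler_pM2l x0) mulr1.
have : y * (1 + c * x) <= x.
  have cx : 0 <= c * x by rewrite mulr_ge0// ltW.
  have : y <= x * (1 - c * x) by lra.
  move=> H; apply: (@le_trans _ _ (x * (1 - c * x) * (1 + c * x))).
    by rewrite ler_wpM2r// addr_ge0.
  by have := mulr_ge0 (ltW x0) (sqr_ge0 (c * x)); lra.
by have := ler_wpM2l y0 xA; lra.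
Qed.

End Rates.

(** * Measures carried by finitely many atoms *)

Section AtomicMeasures.
Variables (R : realType) (disp : measure_display) (T : measurableType disp).
Variables (I : finType) (z : I -> T).

Lemma atomic_measure_exists (w : I -> R) : (forall i, 0 <= w i) ->
  exists m : {measure set T -> \bar R},
    forall A, m A = (\sum_i w i * (\1_A (z i)))%:E.
Proof.
move=> w0; suff H (s : seq I) : exists m : {measure set T -> \bar R},
    forall A, m A = (\sum_(i <- s) w i * (\1_A (z i)))%:E by exact: H.
elim: s => [|i s [m IH]].
  by exists mzero => A; rewrite big_nil.
exists (measure_add (mscale (NngNum (w0 i)) (dirac (z i))) m) => A.
etransitivity; first exact: measure_addE.
by rewrite big_cons EFinD IH /mscale /= /dirac EFinM.
Qed.

(** The total mass is 1, so normalizing the measure changes nothing; the point [i0]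
    is the default value of the normalization. *)
Lemma atomic_probability_exists (i0 : I) (w : I -> R) :
  (forall i, 0 <= w i) -> \sum_i w i = 1 ->
  exists P : probability T R, forall A, P A = (\sum_i w i * (\1_A (z i)))%:E.
Proof.
move=> w0 w1; have [m mE] := atomic_measure_exists w0.
have mT : m setT = 1%E.
  by rewrite mE -w1; congr EFin; apply: eq_bigr => i _; rewrite indicT mulr1.
exists (mnormalize m (dirac (z i0))) => A.
transitivity (mnormalize m (dirac (z i0)) A); first by [].
by rewrite /mnormalize mT onee_eq0 /= invr1 mule1 mE.
Qed.

Section Integral.
Hypotheses (z_inj : injective z) (measurable_atom : forall i, measurable [set z i]).
Variables (P : {measure set T -> \bar R}) (D : set T).
Hypotheses (mD : measurable D) (zD : forall i, D (z i)).
Hypothesis (PD : P (D `\` range z) = 0%E).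

Lemma measurable_range_atoms : measurable (range z).
Proof.
have -> : range z = \big[setU/set0]_i [set z i].
  rewrite -bigcup_seq; apply/seteqP; split => [_ [i _ <-]|x [i _ ->]]; last by exists i.
  by exists i => //=; rewrite mem_index_enum.
by apply: bigsetU_measurable => i _.
Qed.

Lemma ge0_integral_atoms (f : T -> \bar R) : measurable_fun D f ->
  (forall x, D x -> 0 <= f x)%E ->
  (\int[P]_(x in D) f x = \sum_i f (z i) * P [set z i])%E.
Proof.
move=> mf f0; rewrite (ge0_negligible_integral _ mD mf f0 PD); last first.
  exact: measurableD measurable_range_atoms.
have -> : D `\` (D `\` range z) = \big[setU/set0]_i [set z i].
  rewrite setDD -bigcup_seq; apply/seteqP; split => [_ [_ [i _ <-]]|x [i _ ->]].
    by exists i => //=; rewrite mem_index_enum.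
  by split=> //; exists i.
have sub x : (\big[setU/set0]_i [set z i]) x -> D x.
  by rewrite -bigcup_seq => -[i _ ->].
rewrite ge0_integral_bigsetU//; last 4 first.
- exact: index_enum_uniq.
- by move=> i j _ _ [x [-> /z_inj]].
- exact: measurable_funS mf.
- by move=> x /sub /f0.
apply: eq_bigr => i _; rewrite (_ : \int[P]_(x in _) _ = \int[P]_(x in [set z i]) cst (f (z i)) x)%E.
  by rewrite integral_cst.
by apply: eq_integral => x; rewrite inE => ->.
Qed.

(** The value of the integrand may be infinite at an atom without mass: this occurs
    for the logarithm of a density that vanishes there. *)
Lemma integral_atoms (f : T -> \bar R) : measurable_fun D f ->
  (forall i, P [set z i] \is a fin_num) ->
  (forall i, P [set z i] = 0%E \/ f (z i) \is a fin_num) ->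
  (\int[P]_(x in D) f x = (\sum_i fine (f (z i)) * fine (P [set z i]))%:E)%E.
Proof.
move=> mf Pfin ffin; rewrite integralE !ge0_integral_atoms//.
- have H (g : T -> \bar R) : (forall i, P [set z i] = 0%E \/ g (z i) \is a fin_num) ->
      (\sum_i g (z i) * P [set z i] =
       (\sum_i fine (g (z i)) * fine (P [set z i]))%:E)%E.
    move=> gfin; rewrite -sumEFin; apply: eq_bigr => i _.
    have [->|gi] := gfin i; first by rewrite mule0 mulr0.
    by rewrite -(fineK gi) -(fineK (Pfin i)).
  rewrite !H => [| i | i]; last 2 first.
  + have [->|fi] := ffin i; [by left|right]; rewrite funenegE.
    by case: (f (z i)) fi => // r _; rewrite -EFinN -EFin_max.
  + have [->|fi] := ffin i; [by left|right]; rewrite funeposE.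
    by case: (f (z i)) fi => // r _; rewrite -EFin_max.
  rewrite -EFinB -sumrB; congr EFin; apply: eq_bigr => i _; rewrite -mulrBl.
  have [->|fi] := ffin i; first by rewrite !mulr0.
  congr (_ * _); rewrite funeposE funenegE; case: (f (z i)) fi => // r _.
  by rewrite -EFinN -!EFin_max /= /Order.max; do 2 case: ifP; lra.
- exact: measurable_funeneg.
- exact: measurable_funepos.
Qed.

End Integral.

Lemma measure_atoms (P : {measure set T -> \bar R}) (A : set T) :
  injective z -> (forall i, measurable [set z i]) ->
  P (~` range z) = 0%E -> measurable A ->
  P A = (\sum_i (\1_A (z i))%:E * P [set z i])%E.
Proof.
move=> zinj mz P0 mA; rewrite -[A in LHS]setIT -integral_indic//.
rewrite (ge0_integral_atoms zinj mz measurableT)//.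
- by rewrite setTD.
- by apply/measurable_EFinP; exact: measurable_indic.
Qed.

End AtomicMeasures.

(** The superlevel set of [lne] at [a] is that of the identity at [expR a]. *)
Lemma measurable_lne (R : realType) : measurable_fun setT (@lne R).
Proof.
apply: (measurability _ (ErealGenOInfty.measurableE R)).
move=> /= _ [_ [a ->]] <-; apply: measurableI => //.
rewrite (_ : _ @^-1` _ = `](expR a)%:E, +oo[%classic); last first.
  apply/seteqP; split => x /=; rewrite !in_itv/= !andbT.
    case: x => [r| |]//=; last by rewrite !ltry.
    case: ifPn => [r0|]; first by rewrite ltNge leNye.
    rewrite -ltNge => r0; rewrite !lte_fin => ar.
    by rewrite -[r]lnK// ltr_expR.
  case: x => [r| |]//=; last by rewrite !ltry.
  rewrite lte_fin => ar; have r0 : 0 < r := lt_trans (expR_gt0 _) ar.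
  by rewrite leNgt r0/= lte_fin -ltr_expR lnK.
exact: emeasurable_itv.
Qed.

(** * Euclidean distance and Borel sets *)

Section Euclid.
Variables (R : realType) (d : nat).
Implicit Types (x y : 'rV[R]_d) (Omega : set 'rV[R]_d).
Local Notation T := (borel R d).

Lemma edist_ge0 x y : 0 <= edist x y.
Proof. exact: sqrtr_ge0. Qed.

Lemma edistxx x : edist x x = 0.
Proof. by rewrite /edist big1 ?sqrtr0// => i _; rewrite subrr expr0n. Qed.

Lemma edist_gt0 x y : x != y -> 0 < edist x y.
Proof.
move=> xy; rewrite lt_neqAle edist_ge0 andbT eq_sym; apply: contra xy => xy0.
have : \sum_(i < d) (x 0 i - y 0 i) ^+ 2 = 0.
  apply/eqP; rewrite eq_le sumr_ge0 ?andbT => [|i _]; last exact: sqr_ge0.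
  by rewrite -sqrtr_eq0.
move=> /eqP; rewrite psumr_eq0 => [/allP H|i _]; last exact: sqr_ge0.
apply/eqP/rowP => i.
have := H i (mem_index_enum i); rewrite /= sqrf_eq0 subr_eq0.
by move=> /eqP.
Qed.

Lemma coord_le_norm x i : `|x 0 i| <= `|x|.
Proof.
rewrite [leRHS]/Num.norm /= mx_normrE; apply/bigmax_geP; right => /=.
by exists (0, i).
Qed.

Lemma compact_coord_bounded Omega : compact Omega ->
  exists2 M : R, 0 <= M & forall x i, Omega x -> `|x 0 i| <= M.
Proof.
move=> cO.
have /compact_bounded[M [Mreal bM]] := cO.
have M1 : M < `|M| + 1 by rewrite (le_lt_trans (ler_norm M))// ltrDl.
exists (`|M| + 1) => [|x i Ox]; first by rewrite addr_ge0.
by apply: le_trans (bM _ M1 x Ox); exact: coord_le_norm.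
Qed.

Lemma diam_has_ubound Omega : compact Omega ->
  has_ubound [set edist p.1 p.2 | p in Omega `*` Omega].
Proof.
move=> /compact_coord_bounded[M M0 bM].
exists (Num.sqrt (\sum_(i < d) (2 * M) ^+ 2)) => _ [[x y] [/= Ox Oy] <-].
apply: ler_wsqrtr; apply: ler_sum => i _.
rewrite -[(_ - _) ^+ 2]real_normK ?num_real// lerXn2r ?nnegrE ?mulr_ge0//.
by rewrite (le_trans (ler_normB _ _))// mulr2n mulrDl mul1r lerD// bM.
Qed.

Lemma edist_le_diam Omega x y : compact Omega -> Omega x -> Omega y ->
  edist x y <= diam Omega.
Proof.
move=> cO Ox Oy; apply: ub_le_sup; first exact: diam_has_ubound.
by exists (x, y).
Qed.

Lemma separation_le (n : nat) (X : 'I_n -> 'rV[R]_d) i j : i != j ->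
  separation X <= edist (X i) (X j).
Proof.
move=> ij; apply: ge_inf; last by exists (i, j).
by exists 0 => _ [p _ <-]; exact: edist_ge0.
Qed.

Lemma separation_gt0 (n : nat) (X : 'I_n -> 'rV[R]_d) : (2 <= n)%N ->
  injective X -> 0 < separation X.
Proof.
case: n X => [|[|n]]// X _ Xinj.
pose p0 : 'I_n.+2 * 'I_n.+2 := (ord0, ord_max).
have := @arg_minP _ _ _ p0 (fun p => p.1 != p.2) (fun p => edist (X p.1) (X p.2)) isT.
case=> p p12 pmin.
apply: (@lt_le_trans _ _ (edist (X p.1) (X p.2))).
  by apply: edist_gt0; apply: contra p12 => /eqP /Xinj ->.
by apply: lb_le_inf; [exists (edist (X p0.1) (X p0.2)), p0|move=> _ [q /= q12 <-]; exact: pmin].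
Qed.

Lemma open_borel (A : set 'rV[R]_d) : open A -> measurable (A : set T).
Proof. exact: sub_sigma_algebra. Qed.

Lemma closed_borel (A : set 'rV[R]_d) : closed A -> measurable (A : set T).
Proof. by move=> /closed_openC/open_borel/measurableC; rewrite setCK. Qed.

Lemma set1_closed x : closed [set x].
Proof. exact/accessible_closed_set1/hausdorff_accessible/norm_hausdorff. Qed.

Lemma set1_borel x : measurable ([set x] : set T).
Proof. by apply: closed_borel; exact: set1_closed. Qed.

Lemma within_continuous_borel (A : set 'rV[R]_d) (f : 'rV[R]_d -> R) :
  closed A -> {within A, continuous f} -> measurable_fun (A : set T) (f : T -> R).
Proof.
move=> cA cf; apply: (measurability _ (RGenOpens.measurableE R)).
move=> _ [_ [a [b ->] <-]].
have /open_subspaceP[V oV VA] : open (f @^-1` `]a, b[ : set (subspace A)).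
  by move/continuousP: cf; apply; exact: interval_open.
rewrite setIC -VA; apply: measurableI; first exact: open_borel.
exact: closed_borel.
Qed.

Lemma coord_borel i : measurable_fun setT (fun x : T => (x : 'rV[R]_d) 0 i).
Proof.
apply: within_continuous_borel; first exact: closedT.
by apply: continuous_subspaceT => x; exact: coord_continuous.
Qed.

Lemma edist_measurable :
  measurable_fun setT (fun p : T * T => (edist p.1 p.2)%:E).
Proof.
apply/measurable_EFinP; apply: measurableT_comp.
  by apply: continuous_measurable_fun; exact: sqrt_continuous.
apply: measurable_sum => i; apply: measurable_funX; apply: measurable_funB.
  by apply: (measurableT_comp (coord_borel i)); exact: measurable_fst.
by apply: (measurableT_comp (coord_borel i)); exact: measurable_snd.
Qed.

End Euclid.

(** * Mass vectors of measures on the mesh *)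

Section Atoms.
Variables (R : realType) (d n : nat) (X : 'I_n -> 'rV[R]_d).
Hypothesis X_inj : injective X.
Local Notation T := (borel R d).
Implicit Types mu nu : probability T R.

Definition masses mu : 'I_n -> R := fun i => mass mu (X i).

Lemma massesE mu i : mu [set X i] = (masses mu i)%:E.
Proof. by rewrite /masses /mass fineK// fin_num_measure//; exact: set1_borel. Qed.

Lemma range_borel : measurable (range X : set T).
Proof. by apply: (@measurable_range_atoms _ T) => i; exact: set1_borel. Qed.

Lemma prob_on_null mu : prob_on (range X) mu -> mu (~` range X) = 0%E.
Proof.
by move=> muX; rewrite probability_setC ?muX ?subee//; exact: range_borel.
Qed.

Lemma masses_measure mu (A : set T) : prob_on (range X) mu -> measurable A ->
  mu A = (\sum_i masses mu i * \1_A (X i))%:E.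
Proof.
move=> muX mA; have mX i : measurable ([set X i] : set T) by exact: set1_borel.
etransitivity; first exact: (@measure_atoms R _ T _ X mu A X_inj mX (prob_on_null muX)).
by rewrite -sumEFin; apply: eq_bigr => i _; rewrite [RHS]EFinM -massesE [RHS]muleC.
Qed.

Lemma masses_distr mu : prob_on (range X) mu -> distr (masses mu).
Proof.
move=> muX; split=> [i|]; first by rewrite /masses /mass fine_ge0.
have := probability_setT mu; rewrite masses_measure// => -[<-].
by apply: eq_bigr => i _; rewrite indicT mulr1.
Qed.

Lemma prob_with_masses (p : 'I_n -> R) : distr p ->
  exists mu, prob_on (range X) mu /\ masses mu = p.
Proof.
move=> [p0 p1].
have [i0 _] : exists i0 : 'I_n, True.
  case: n p p0 p1 => [|k] p _ p1; last by exists ord0.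
  by move: p1; rewrite big_ord0 => /eqP; rewrite eq_sym oner_eq0.
have [mu muE] := @atomic_probability_exists R _ T _ X i0 p p0 p1.
exists mu; split.
  rewrite /prob_on muE -p1; congr EFin; apply: eq_bigr => i _.
  by rewrite indicE mem_set ?mulr1//; exists i.
apply/funext => i; rewrite /masses /mass muE/= (bigD1 i)//= indicE mem_set//= mulr1.
rewrite big1 ?addr0// => j ji; rewrite indicE memNset ?mulr0//= => /X_inj ij.
by rewrite ij eqxx in ji.
Qed.

Lemma prob_on_sub (A : set 'rV[R]_d) mu : measurable (A : set T) ->
  (forall i, A (X i)) -> prob_on (range X) mu -> prob_on A mu.
Proof.
move=> mA AX muX; rewrite /prob_on masses_measure// -[RHS]/(1%:E).
rewrite -(masses_distr muX).2; congr EFin; apply: eq_bigr => i _.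
by rewrite indicE mem_set ?mulr1.
Qed.

Lemma masses_same mu nu : prob_on (range X) mu -> prob_on (range X) nu ->
  masses mu = masses nu -> same_measure mu nu.
Proof. by move=> muX nuX E A mA; rewrite !masses_measure// E. Qed.

Lemma Rintegral_masses (A : set 'rV[R]_d) mu (f : 'rV[R]_d -> R) :
  closed A -> (forall i, A (X i)) -> prob_on (range X) mu ->
  {within A, continuous f} ->
  \int[mu]_(x in A) f x = \sum_i masses mu i * f (X i).
Proof.
move=> cA AX muX cf; rewrite /Rintegral.
rewrite (@integral_atoms R _ T _ X)//=.
- by apply: eq_bigr => i _; rewrite mulrC.
- by move=> i; exact: set1_borel.
- exact: closed_borel.
- apply/eqP; rewrite eq_le measure_ge0 andbT -(prob_on_null muX).
  apply: le_measure; rewrite ?inE//.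
  + by apply: measurableD; [exact: closed_borel|exact: range_borel].
  + by apply: measurableC; exact: range_borel.
- by apply/measurable_EFinP; exact: within_continuous_borel.
- by move=> i; apply: fin_num_measure; exact: set1_borel.
- by move=> i; right.
Qed.

Lemma pairing_masses (A : set 'rV[R]_d) rho sigma (f : 'rV[R]_d -> R) :
  closed A -> (forall i, A (X i)) ->
  prob_on (range X) rho -> prob_on (range X) sigma ->
  {within A, continuous f} ->
  pairing A f rho sigma = \sum_i f (X i) * (masses rho i - masses sigma i).
Proof.
move=> cA AX rX sX cf; rewrite /pairing !Rintegral_masses// -sumrB.
by apply: eq_bigr => i _; ring.
Qed.

Lemma image_closed (A : set 'I_n) : closed (X @` A).
Proof.
have acc : accessible_space 'rV[R]_d by exact/hausdorff_accessible/norm_hausdorff.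
by move/accessible_finite_set_closed: acc; apply; exact/finite_image/finite_finset.
Qed.

(** Points of a finite set are isolated from the others by an open set. *)
Lemma masses_gt0_supp mu i : prob_on (range X) mu ->
  supp mu (X i) <-> 0 < masses mu i.
Proof.
move=> muX; split=> [sup|mi U oU UX]; last first.
  rewrite masses_measure ?lte_fin//; last exact: open_borel.
  rewrite (bigD1 i)//= indicE mem_set//= mulr1 ltr_pwDl//.
  by apply: sumr_ge0 => j _; rewrite mulr_ge0//; have [] := masses_distr muX.
pose U := ~` (X @` [set j | j != i]).
have UX : U (X i) by move=> [j /= ji /X_inj ij]; rewrite ij eqxx in ji.
have oU : open U by apply: closed_openC; exact: image_closed.
have := sup U oU UX; rewrite masses_measure ?lte_fin//; last exact: open_borel.
rewrite (bigD1 i)//= big1 ?addr0 => [|j ji].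
  by rewrite indicE mem_set//= mulr1.
by rewrite indicE memNset ?mulr0// => H; apply: H; exists j.
Qed.

Lemma supp_sub_range mu : prob_on (range X) mu -> supp mu `<=` range X.
Proof.
move=> muX x sx; apply: contrapT => nx.
have oU : open (~` range X) by apply: closed_openC; exact: image_closed.
by have := sx _ oU nx; rewrite prob_on_null// ltxx.
Qed.

End Atoms.

(** * Wasserstein distance on the mesh *)

Section Plans.
Variables (R : realType) (d n : nat) (X : 'I_n -> 'rV[R]_d).
Hypothesis X_inj : injective X.
Local Notation T := (borel R d).
Local Notation masses := (masses X).
Implicit Types (mu nu : probability T R) (p q : 'I_n -> R) (c : 'I_n -> 'I_n -> R).

(** Couplings of measures carried by the mesh, as matrices. *)
Definition plan c p q : Prop :=
  [/\ forall i j, 0 <= c i j, forall i, \sum_j c i j = p i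
    & forall j, \sum_i c i j = q j].

Definition cost c : R := \sum_i \sum_j c i j * edist (X i) (X j).

(* the possible atoms of a coupling *)
Let z (k : 'I_n * 'I_n) : (T * T)%type := (X k.1, X k.2).

Let z_inj : injective z.
Proof. by move=> [i j] [i' j'] [/X_inj -> /X_inj ->]. Qed.

Let atom_z k : measurable [set z k].
Proof.
have -> : [set z k] = ([set X k.1] : set T) `*` ([set X k.2] : set T).
  by apply/seteqP; split=> [_ ->//|[x y] [/= -> ->]].
by apply: measurableX; exact: set1_borel.
Qed.

Lemma coupling_plan mu nu pi :
  prob_on (range X) mu -> prob_on (range X) nu -> coupling mu nu pi ->
  exists2 c, plan c (masses mu) (masses nu) &
    (\int[pi]_x (edist x.1 x.2)%:E)%E = (cost c)%:E.
Proof.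
move=> muX nuX [pi1 pi2].
have mX : measurable (range X : set T) := range_borel X.
have pi0 : pi (~` range z) = 0%E.
  apply/eqP; rewrite eq_le measure_ge0 andbT.
  apply: (@le_trans _ _ (pi ((~` range X `*` setT) `|` (setT `*` ~` range X)))).
    apply: le_measure; rewrite ?inE.
    - exact/measurableC/measurable_range_atoms.
    - by apply: measurableU; apply: measurableX => //; exact: measurableC.
    - move=> [x y] /= nz; have [[i _ ix]|nx] := pselect (range X x); last by left.
      right; split=> // -[j _ jy]; apply: nz; exists (i, j) => //.
      by rewrite /z /= ix jy.
  apply: le_trans (measureU2 _ _ _) _.
  - by apply: measurableX => //; exact: measurableC.
  - by apply: measurableX => //; exact: measurableC.
  have e1 : pi (~` range X `*` setT) = 0%E.
    by rewrite pi1 ?prob_on_null//; exact: measurableC.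
  have e2 : pi (setT `*` ~` range X) = 0%E.
    by rewrite pi2 ?prob_on_null//; exact: measurableC.
  by rewrite -[leRHS]adde0 -{1}e1 -{1}e2; exact: lexx.
have zfin k : pi [set z k] \is a fin_num by exact: fin_num_measure.
pose c i j := fine (pi [set z (i, j)]).
have piE A : measurable A -> pi A = (\sum_i \sum_j \1_A (z (i, j)) * c i j)%:E.
  move=> mA; rewrite (measure_atoms z_inj atom_z pi0 mA) pair_bigA/= -sumEFin.
  by apply: eq_bigr => -[i j] _ /=; rewrite EFinM /c fineK.
exists c.
  split=> [i j|i|j]; first by rewrite /c fine_ge0.
  - have := pi1 [set X i] (set1_borel _).
    rewrite piE ?massesE; last by apply: measurableX => //; exact: set1_borel.
    move=> -[<-]; rewrite [RHS](bigD1 i)//= [X in _ = _ + X]big1 ?addr0 => [|k ki].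
      by apply: eq_bigr => j _; rewrite indicE mem_set ?mul1r.
    apply: big1 => j _; rewrite indicE memNset ?mul0r// => -[/= /X_inj kE _].
    by rewrite kE eqxx in ki.
  - have := pi2 [set X j] (set1_borel _).
    rewrite piE ?massesE; last by apply: measurableX => //; exact: set1_borel.
    move=> -[<-]; rewrite [RHS]exchange_big/= [RHS](bigD1 j)//= [X in _ = _ + X]big1 ?addr0 => [|k ki].
      by apply: eq_bigr => i _; rewrite indicE mem_set ?mul1r.
    apply: big1 => i _; rewrite indicE memNset ?mul0r// => -[/= _ /X_inj kE].
    by rewrite kE eqxx in ki.
rewrite (@ge0_integral_atoms R _ _ _ z z_inj atom_z _ setT)//.
- rewrite /cost pair_bigA/= -sumEFin; apply: eq_bigr => -[i j] _ /=.
  by rewrite [RHS]EFinM /c fineK// [RHS]muleC.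
- by rewrite setTD.
- exact: edist_measurable.
- by move=> x _; rewrite lee_fin edist_ge0.
Qed.

Lemma plan_coupling mu nu c :
  prob_on (range X) mu -> prob_on (range X) nu -> plan c (masses mu) (masses nu) ->
  exists2 pi, coupling mu nu pi &
    (\int[pi]_x (edist x.1 x.2)%:E)%E = (cost c)%:E.
Proof.
move=> muX nuX [c0 c1 c2].
have sumc : \sum_(k : 'I_n * 'I_n) c k.1 k.2 = 1.
  rewrite -(pair_bigA _ c)/= -(masses_distr X_inj muX).2; exact: eq_bigr.
have [k0 _] : exists k0 : 'I_n * 'I_n, True.
  apply: contrapT => none; move: sumc; rewrite big1 => [/esym/eqP|k _].
    by rewrite oner_eq0.
  by exfalso; apply: none; exists k.
have [pi piE] := @atomic_probability_exists R _ _ _ z k0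
  (fun k => c k.1 k.2) (fun k => c0 _ _) sumc.
have pi_atom k : pi [set z k] = (c k.1 k.2)%:E.
  rewrite piE (bigD1 k)//= indicE mem_set//= mulr1 big1 ?addr0// => l lk.
  by rewrite indicE memNset ?mulr0//= => /z_inj E; rewrite E eqxx in lk.
exists pi.
  split=> A mA; rewrite piE.
    rewrite (masses_measure X_inj muX mA); congr EFin.
    rewrite -(pair_bigA _ (fun i j => c i j * \1_(A `*` setT) (z (i, j))))/=.
    apply: eq_bigr => i _; rewrite -c1 mulr_suml; apply: eq_bigr => j _.
    by rewrite !indicE in_setX/= [(_ : T) \in setT]mem_set ?andbT.
  rewrite (masses_measure X_inj nuX mA); congr EFin.
  rewrite -(pair_bigA _ (fun i j => c i j * \1_(setT `*` A) (z (i, j))))/=.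
  rewrite exchange_big/=; apply: eq_bigr => j _; rewrite -c2 mulr_suml.
  apply: eq_bigr => i _.
  by rewrite !indicE in_setX/= [(_ : T) \in setT]mem_set.
rewrite (@ge0_integral_atoms R _ _ _ z z_inj atom_z _ setT)//.
- rewrite /cost pair_bigA/= -sumEFin; apply: eq_bigr => -[i j] _ /=.
  by rewrite [RHS]EFinM [RHS]muleC; congr (_ * _)%E; exact: pi_atom.
- rewrite setTD; etransitivity; first exact: piE.
  rewrite big1// => k _; rewrite indicE memNset ?mulr0// => H; apply: H.
  by exists k.
- exact: edist_measurable.
- by move=> x _; rewrite lee_fin edist_ge0.
Qed.

Lemma cost_ge0 c p q : plan c p q -> 0 <= cost c.
Proof.
move=> [c0 _ _]; apply: sumr_ge0 => i _; apply: sumr_ge0 => j _.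
by rewrite mulr_ge0 ?edist_ge0.
Qed.

Lemma product_plan p q : distr p -> distr q -> plan (fun i j => p i * q j) p q.
Proof.
move=> [p0 p1] [q0 q1]; split=> [i j|i|j]; first by rewrite mulr_ge0.
  by rewrite -mulr_sumr q1 mulr1.
by rewrite -mulr_suml p1 mul1r.
Qed.

Lemma diag_plan p : distr p -> plan (fun i j => (i == j)%:R * p i) p p.
Proof.
move=> [p0 p1]; split=> [i j|i|j]; first by rewrite mulr_ge0.
  rewrite (bigD1 i)//= eqxx mul1r big1 ?addr0// => j ji.
  by rewrite eq_sym (negbTE ji) mul0r.
rewrite (bigD1 j)//= eqxx mul1r big1 ?addr0// => i ij.
by rewrite (negbTE ij) mul0r.
Qed.

Section Wasserstein.
Variables mu nu : probability T R.
Hypotheses (muX : prob_on (range X) mu) (nuX : prob_on (range X) nu).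

Let costs := [set (\int[pi]_x (edist x.1 x.2)%:E)%E | pi in coupling mu nu].

Let inf_fin : ereal_inf costs \is a fin_num.
Proof.
have [pi piC cpi] :=
  plan_coupling muX nuX (product_plan (masses_distr X_inj muX) (masses_distr X_inj nuX)).
rewrite ge0_fin_numE; last first.
  by apply/ereal_infP => _ [pi' _ <-]; apply: integral_ge0 => x _; rewrite lee_fin edist_ge0.
apply: (@le_lt_trans _ _ (\int[pi]_x (edist x.1 x.2)%:E)%E).
  by apply: ereal_inf_lbound; exists pi.
by rewrite cpi ltry.
Qed.

Lemma W1_le_cost c : plan c (masses mu) (masses nu) -> W1 mu nu <= cost c.
Proof.
move=> /(plan_coupling muX nuX)[pi piC cpi].
rewrite -lee_fin -cpi /W1 fineK//; apply: ereal_inf_lbound; by exists pi.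
Qed.

Lemma W1_ge a : (forall c, plan c (masses mu) (masses nu) -> a <= cost c) ->
  a <= W1 mu nu.
Proof.
move=> H; rewrite -lee_fin /W1 fineK//; apply/ereal_infP => _ [pi piC <-].
by have [c cP ->] := coupling_plan muX nuX piC; rewrite lee_fin; exact: H.
Qed.

Lemma W1_ge0 : 0 <= W1 mu nu.
Proof. by apply: W1_ge => c cP; exact: (cost_ge0 cP). Qed.

End Wasserstein.

Lemma sum_pos_part p q : distr p -> distr q ->
  \sum_i Num.max (p i - q i) 0 = l1 p q / 2.
Proof.
move=> [_ p1] [_ q1].
have : \sum_i (2 * Num.max (p i - q i) 0) = \sum_i (`|p i - q i| + (p i - q i)).
  apply: eq_bigr => i _; case: (lerP (p i - q i) 0) => h.
    by rewrite ler0_norm//; ring.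
  by rewrite gtr0_norm//; ring.
rewrite -mulr_sumr big_split/= sumrB p1 q1 subrr addr0 -/(l1 p q) => <-.
by rewrite mulrC mulrA mulVf ?mul1r// pnatr_eq0.
Qed.

(** Mass in excess of [q i] at the point [i] has to leave it, and each move costs at
    least [s]. *)
Lemma cost_ge_l1 c p q (s : R) : distr p -> distr q ->
  (forall i j, i != j -> s <= edist (X i) (X j)) -> 0 <= s ->
  plan c p q -> s * (l1 p q / 2) <= cost c.
Proof.
move=> dp dq sX s0 [c0 c1 c2].
rewrite -sum_pos_part// mulr_sumr; apply: ler_sum => i _.
apply: (@le_trans _ _ (s * \sum_(j | j != i) c i j)).
  rewrite ler_wpM2l// ge_max sumr_ge0// andbT lerBlDr.
  rewrite -c1 (bigD1 i)//= addrC lerD2l -c2 (bigD1 i)//= lerDl.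
  exact: sumr_ge0.
rewrite [leRHS](bigD1 i)//= edistxx mulr0 add0r mulr_sumr; apply: ler_sum => j ji.
by rewrite mulrC ler_wpM2l// sX// eq_sym.
Qed.

(** Perturbation of the first marginal: in the row [i], remove the fraction [e i] by
    which [v i] exceeds [p i]; the removed mass has total [t] and second marginal
    [r], and it is sent out again from the points where [p] exceeds [v].  Only this
    mass can increase the cost, by at most [D] per unit. *)
Lemma replan c p v q (D : R) : distr p -> distr v ->
  (forall i j, edist (X i) (X j) <= D) -> plan c v q ->
  exists2 c', plan c' p q & cost c' <= cost c + D * (l1 p v / 2).
Proof.
move=> dp dv XD [c0 c1 c2].
pose t := l1 p v / 2.
have [pv|tn0] := eqVneq t 0.
  have E i : p i = v i.
    apply/eqP; rewrite -subr_eq0 -normr_le0.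
    have := dist_le_half_l1 i dp dv; have : l1 p v = 0 by rewrite /t in pv; lra.
    lra.
  exists c; last by rewrite -/t pv mulr0 addr0.
  by split=> // i; rewrite c1 E.
have t0 : 0 < t by rewrite lt_neqAle eq_sym tn0 divr_ge0 ?l1_ge0.
pose a i := Num.max (p i - v i) 0.
pose b i := Num.max (v i - p i) 0.
have a0 i : 0 <= a i by rewrite le_max lexx orbT.
have b0 i : 0 <= b i by rewrite le_max lexx orbT.
have ab i : v i - b i + a i = p i.
  by rewrite /a /b; case: (lerP (p i - v i) 0); case: (lerP (v i - p i) 0); lra.
have bv i : b i <= v i.
  by rewrite /b ge_max (dv.1 i) andbT lerBlDr lerDl; exact: dp.1.
have sa : \sum_i a i = t by exact: sum_pos_part.
have sb : \sum_i b i = t by rewrite /t l1C; exact: sum_pos_part.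
pose e i := b i / v i.
(* if [v i = 0] then [b i = 0], and [e i = 0] by the convention on inverses *)
have e0 i : 0 <= e i by rewrite divr_ge0//; exact: dv.1.
have ev i : e i * v i = b i.
  have [vi|vi] := eqVneq (v i) 0; last by rewrite /e divfK.
  by apply/eqP; rewrite vi mulr0 eq_sym eq_le b0 andbT -vi.
have e1 i : e i <= 1.
  have [vi|vi] := eqVneq (v i) 0; first by rewrite /e vi invr0 mulr0 ler01.
  have {}vi : 0 < v i by rewrite lt_neqAle eq_sym vi; exact: dv.1.
  by rewrite ler_pdivrMr ?mul1r.
pose r j := \sum_i e i * c i j.
have r0 j : 0 <= r j.
  by apply: sumr_ge0 => i _; rewrite mulr_ge0.
have sr : \sum_j r j = t.
  rewrite exchange_big/= -sb; apply: eq_bigr => i _.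
  by rewrite -mulr_sumr c1 ev.
pose c' i j := (1 - e i) * c i j + a i * r j / t.
exists c'.
  split=> [i j|i|j].
  - rewrite addr_ge0 ?mulr_ge0 ?invr_ge0 ?(ltW t0)// subr_ge0 e1//.
  - rewrite big_split/= -mulr_sumr c1 -mulr_suml -mulr_sumr sr mulfK//.
    by rewrite -[RHS]ab mulrBl mul1r ev.
  - rewrite big_split/= -!mulr_suml sa mulrAC divff// mul1r -c2.
    by rewrite -[X in _ + X]/(\sum_i e i * c i j) -big_split/=; apply: eq_bigr => i _; ring.
rewrite -/t -[t in leRHS]sa mulr_sumr -big_split /=; apply: ler_sum => i _.
have -> : D * a i = \sum_j D * (a i * r j / t).
  by rewrite -mulr_sumr -mulr_suml -mulr_sumr sr mulfK.
rewrite -big_split/=; apply: ler_sum => j _.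
rewrite mulrDl lerD//; last first.
  by rewrite mulrC ler_wpM2r// !mulr_ge0// invr_ge0 ltW.
rewrite ler_wpM2r ?edist_ge0// mulrBl mul1r lerBlDr lerDl.
exact: mulr_ge0.
Qed.

Section WassersteinComparison.
Variable D : R.
Hypothesis XD : forall i j, edist (X i) (X j) <= D.
Implicit Types rho : probability T R.

Lemma W1_shift mu nu rho :
  prob_on (range X) mu -> prob_on (range X) nu -> prob_on (range X) rho ->
  W1 mu rho <= W1 nu rho + D * (l1 (masses mu) (masses nu) / 2).
Proof.
move=> muX nuX rX; rewrite -lerBlDr; apply: W1_ge => // c cP.
have [c' c'P cc'] :=
  replan (masses_distr X_inj muX) (masses_distr X_inj nuX) XD cP.
by rewrite lerBlDr (le_trans _ cc')//; exact: W1_le_cost.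
Qed.

(** Case [rho = nu] of [W1_shift], since the diagonal plan costs nothing. *)
Lemma W1_le_l1 mu nu :
  prob_on (range X) mu -> prob_on (range X) nu ->
  W1 mu nu <= D * (l1 (masses mu) (masses nu) / 2).
Proof.
move=> muX nuX; rewrite -[leRHS]add0r.
apply: le_trans (W1_shift muX nuX nuX) _; rewrite lerD2r.
apply: le_trans (W1_le_cost nuX nuX (diag_plan (masses_distr X_inj nuX))) _.
rewrite /cost big1// => i _; apply: big1 => j _.
by have [->|ij] := eqVneq i j; rewrite ?edistxx ?mulr0 ?mul0r.
Qed.

Lemma l1_le_W1 s mu nu : 0 <= s ->
  (forall i j, i != j -> s <= edist (X i) (X j)) ->
  prob_on (range X) mu -> prob_on (range X) nu ->
  s * (l1 (masses mu) (masses nu) / 2) <= W1 mu nu.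
Proof.
move=> s0 sX muX nuX; apply: W1_ge => // c; apply: cost_ge_l1 => //.
  exact: masses_distr.
exact: masses_distr.
Qed.

End WassersteinComparison.
End Plans.

(** * Kullback-Leibler divergence on the mesh *)

Section KullbackLeibler.
Variables (R : realType) (d n : nat) (X : 'I_n -> 'rV[R]_d).
Hypothesis X_inj : injective X.
Local Notation T := (borel R d).
Local Notation masses := (masses X).
Variables eta mu : probability T R.
Hypotheses (etaX : prob_on (range X) eta) (muX : prob_on (range X) mu).
Hypothesis mu_gt0 : forall i, 0 < masses mu i.

Lemma full_support_dominates : eta `<< mu.
Proof.
apply/null_content_dominatesP => A mA.
rewrite (masses_measure X_inj etaX mA) => muA.
have : \sum_i masses mu i * \1_A (X i) == 0.
  by rewrite -(inj_eq (@EFin_inj R)) -(masses_measure X_inj muX mA); apply/eqP.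
rewrite psumr_eq0 => [/allP H|i _]; last by rewrite mulr_ge0 ?(ltW (mu_gt0 i)).
congr EFin; apply: big1 => i _.
have := H i (mem_index_enum i); rewrite mulf_eq0 gt_eqF//= => /eqP ->.
by rewrite mulr0.
Qed.

Local Open Scope charge_scope.

(** The derivative is only defined almost everywhere, but an atom with mass is not
    negligible: integrate over it. *)
Lemma Radon_Nikodym_atom i :
  ('d (charge_of_finite_measure eta) '/d mu) (X i) =
  (masses eta i / masses mu i)%:E.
Proof.
set g := 'd _ '/d _.
have mXi : measurable ([set X i] : set T) by exact: set1_borel.
have := Radon_Nikodym_integral (nu := charge_of_finite_measure eta) full_support_dominates mXi.
rewrite -/g (_ : \int[mu]_(x in _) _ = \int[mu]_(x in [set X i]) cst (g (X i)) x)%E; last first.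
  by apply: eq_integral => x; rewrite inE => ->.
rewrite integral_cst// => H.
have {}H : (masses eta i)%:E = (g (X i) * (masses mu i)%:E)%E by rewrite -!massesE.
have gfin : g (X i) \is a fin_num := Radon_Nikodym_fin_num (nu := charge_of_finite_measure eta) _ full_support_dominates.
move: H; rewrite -(fineK gfin) -EFinM => -[->].
by rewrite mulfK// gt_eqF.
Qed.

Lemma KL_masses : KL eta mu = (kl (masses eta) (masses mu))%:E.
Proof.
rewrite /KL asboolT; last exact: full_support_dominates.
set g := 'd _ '/d _.
have gE i : lne (g (X i)) = lne (masses eta i / masses mu i)%:E.
  by rewrite -Radon_Nikodym_atom.
rewrite (@integral_atoms R _ T _ X)//.
- congr EFin; apply: eq_bigr => i _.
  rewrite gE -[fine (eta _)]/(masses eta i) mulrC.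
  have [->|ei] := eqVneq (masses eta i) 0; first by rewrite !mul0r.
  have {}ei : 0 < masses eta i.
    by rewrite lt_neqAle eq_sym ei (masses_distr X_inj etaX).1.
  by rewrite lne_EFin ?divr_gt0.
- by move=> i; exact: set1_borel.
- by rewrite setTD; exact: (prob_on_null etaX).
- by apply: measurableT_comp; [exact: measurable_lne|exact/measurable_int/Radon_Nikodym_integrable/full_support_dominates].
- by move=> i; apply: fin_num_measure; exact: set1_borel.
- move=> i; have [e0|ei] := eqVneq (masses eta i) 0.
    by left; have := massesE X eta i; rewrite e0.
  have {}ei : 0 < masses eta i.
    by rewrite lt_neqAle eq_sym ei (masses_distr X_inj etaX).1.
  by right; rewrite gE lne_EFin ?divr_gt0.
Qed.

End KullbackLeibler.

(** * Strongly monotone variational inequalities on the simplex *)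

Section RowVectors.
Variables (R : realType) (n : nat).
Implicit Types v w : 'rV[R]_n.

Lemma lipschitz_within (K : set 'rV[R]_n) (f : 'rV[R]_n -> R) (C : R) :
  (forall v w, K v -> K w -> `|f v - f w| <= C * `|v - w|) ->
  {within K, continuous f}.
Proof.
move=> fC; apply/subspace_continuousP => v Kv; apply/cvgrPdist_le => e e0.
have C1 : 0 < `|C| + 1 by rewrite ltr_wpDl.
near=> w.
have Kw : K w by near: w; exact: withinT.
apply: le_trans (fC _ _ Kv Kw) _.
apply: (@le_trans _ _ ((`|C| + 1) * `|v - w|)).
  by rewrite ler_wpM2r// (le_trans (ler_norm C))// lerDl.
rewrite mulrC -ler_pdivlMr// ltW//.
near: w; apply: cvg_within.
have eC : 0 < e / (`|C| + 1) by rewrite divr_gt0.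
by have /cvgrPdist_lt/(_ _ eC) : w @[w --> v] --> v by exact: cvg_id.
Unshelve. all: by end_near. Qed.

Definition simplex : set 'rV[R]_n := [set v | distr (v 0)].

Lemma simplex_compact : compact simplex.
Proof.
have -> : simplex = [set v : 'rV[R]_n | forall i, v ord0 i \in `[0, 1]] `&`
                    [set v : 'rV[R]_n | \sum_i v 0 i = 1].
  apply/seteqP; split => [v dv|v [/= v01 v1]]; split => //=.
  - by move=> i; rewrite in_itv/= (distr_le1 i dv) dv.1.
  - exact: dv.2.
  - by move=> i; have := v01 i; rewrite in_itv => /andP[].
apply: compact_closedI.
  apply: (@rV_compact R n (fun=> `[(0 : R), 1]%classic)).
  by move=> _; exact: segment_compact.
apply: (@closed_comp _ _ (fun v : 'rV[R]_n => \sum_i v 0 i) [set 1]).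
  move=> v _; apply: (continuous_big (@add_continuous R)) => i _ w; exact: coord_continuous.
exact: closed_eq.
Qed.

End RowVectors.

Section VariationalInequality.
Variables (R : realType) (n : nat).
Implicit Types (p q z w : 'I_n -> R).

Definition sqdist p q : R := \sum_i (p i - q i) ^+ 2.

Lemma sqdist_ge0 p q : 0 <= sqdist p q.
Proof. by apply: sumr_ge0 => i _; exact: sqr_ge0. Qed.

(** Lipschitz functions of mass vectors for the l1 distance are continuous for the
    sup norm of row vectors, in which the simplex is compact. *)
Lemma simplex_argmin (g : ('I_n -> R) -> R) (C : R) : (0 < n)%N ->
  (forall p q, distr p -> distr q -> `|g p - g q| <= C * l1 p q) ->
  exists2 p, distr p & forall q, distr q -> g p <= g q.
Proof.
move=> n0 gC.
have S0 : @simplex R n !=set0.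
  exists (\row_i (i == Ordinal n0)%:R); split=> [i|]; first by rewrite mxE.
  rewrite (bigD1 (Ordinal n0))//= mxE eqxx big1 ?addr0// => i /negbTE ni.
  by rewrite mxE ni.
have gl : {within @simplex R n, continuous (fun v => g (v 0))}.
  apply: (@lipschitz_within _ _ _ _ (`|C| * n%:R)) => v w Sv Sw.
  apply: le_trans (gC _ _ Sv Sw) _.
  apply: (@le_trans _ _ (`|C| * l1 (v 0) (w 0))).
    by rewrite ler_wpM2r ?l1_ge0// ler_norm.
  rewrite -mulrA ler_wpM2l// mulrC mulr_natr /l1.
  apply: (@le_trans _ _ (\sum_(i < n) `|v - w|)).
    by apply: ler_sum => i _; have := coord_le_norm (v - w) i; rewrite !mxE.
  by rewrite sumr_const card_ord.
have [v] := compact_EVT_min S0 (@simplex_compact R n) gl.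
rewrite inE => Sv vmin; exists (v 0) => // q dq.
have rowq : (\row_i q i : 'rV[R]_n) 0 = q by apply/funext => i; rewrite mxE.
by have := vmin (\row_i q i); rewrite rowq; apply; rewrite inE /simplex /= rowq.
Qed.

Lemma sqr_lipschitz (a b M : R) : `|a| <= M -> `|b| <= M ->
  `|a ^+ 2 - b ^+ 2| <= 2 * M * `|a - b|.
Proof.
move=> aM bM; rewrite subr_sqr normrM mulrC ler_wpM2r//.
by rewrite (le_trans (ler_normD _ _))// mulr2n mulrDl mul1r lerD.
Qed.

(** The variational characterization of the Euclidean projection of [z] onto the
    simplex. *)
Definition is_projection z p : Prop :=
  distr p /\ forall q, distr q -> \sum_i (z i - p i) * (q i - p i) <= 0.

Lemma projection_exists z : (0 < n)%N -> exists p, is_projection z p.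
Proof.
move=> n0; pose M := \sum_i (1 + `|z i|).
have Mi p i : distr p -> `|p i - z i| <= M.
  move=> dp; rewrite /M (bigD1 i)//=.
  apply: (@le_trans _ _ (1 + `|z i|)); last first.
    by rewrite lerDl; apply: sumr_ge0 => j _; rewrite addr_ge0.
  rewrite (le_trans (ler_normB _ _))// lerD2r ger0_norm; last exact: dp.1.
  exact: distr_le1.
have [||p dp pmin] := @simplex_argmin (sqdist^~ z) (2 * M) => //.
  move=> p q dp dq; rewrite /sqdist -sumrB mulr_sumr.
  apply: le_trans (ler_norm_sum _ _ _) _; apply: ler_sum => i _.
  apply: le_trans (sqr_lipschitz (Mi _ i dp) (Mi _ i dq)) _.
  by rewrite (_ : p i - z i - (q i - z i) = p i - q i)//; ring.
exists p; split=> // q dq.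
set s := \sum_i _.
(* first-order optimality: move from [p] towards [q] by the fraction [t] *)
have step (t : R) : 0 < t <= 1 -> 2 * s <= t * sqdist q p.
  move=> /andP[t0 t1].
  pose r i := (1 - t) * p i + t * q i.
  have dr : distr r.
    split=> [i|]; last by rewrite big_split/= -!mulr_sumr dp.2 dq.2; ring.
    by rewrite addr_ge0// mulr_ge0 ?subr_ge0 ?(ltW t0)//; [exact: dp.1|exact: dq.1].
  have := pmin r dr.
  have -> : sqdist r z = sqdist p z + t * (t * sqdist q p - 2 * s).
    rewrite /sqdist /s !mulr_sumr -sumrB mulr_sumr -big_split/=.
    by apply: eq_bigr => i _; rewrite /r; ring.
  by rewrite lerDl pmulr_rge0// subr_ge0.
rewrite leNgt; apply/negP => s0.
(* small enough for [t * sqdist q p] not to exceed [s] *)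
pose t := s / (s + sqdist q p).
have D0 : 0 < s + sqdist q p by rewrite ltr_wpDr// sqdist_ge0.
have /step : 0 < t <= 1.
  by rewrite divr_gt0//= ler_pdivrMr// mul1r lerDl sqdist_ge0.
have : t * sqdist q p <= s.
  by rewrite mulrAC ler_pdivrMr// ler_wpM2l ?(ltW s0)// lerDr ltW.
lra.
Qed.

Lemma projection_nonexpansive z w p q :
  is_projection z p -> is_projection w q -> sqdist p q <= sqdist z w.
Proof.
move=> [dp Hp] [dq Hq]; have := Hp q dq; have := Hq p dp => H1 H2.
have : 0 <= sqdist z w - sqdist p q +
    2 * (\sum_i (w i - q i) * (p i - q i) + \sum_i (z i - p i) * (q i - p i)).
  rewrite /sqdist -big_split mulr_sumr -sumrB -big_split /=.
  apply: sumr_ge0 => i _; have := sqr_ge0 ((z i - w i) - (p i - q i)); nra.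
lra.
Qed.

Variable F : ('I_n -> R) -> 'I_n -> R.
Variables K c : R.
Hypotheses (n_gt0 : (0 < n)%N) (c_gt0 : 0 < c).
Hypothesis F_lip : forall p q i, distr p -> distr q ->
  `|F p i - F q i| <= K * l1 p q.
Hypothesis F_mono : forall p q, distr p -> distr q ->
  c * l1 p q ^+ 2 <= \sum_i (F p i - F q i) * (p i - q i).

(** The solutions are the fixed points of the projected step [T].  For a short step
    [T] decreases distances strictly, so that at a minimum of the distance from
    [p] to [T p] the two points coincide: otherwise [T p] would do better. *)
Lemma VI_solution_exists :
  exists2 p, distr p & forall q, distr q -> 0 <= \sum_i F p i * (q i - p i).
Proof.
(* the second-order term [tau ^+ 2 * n * K ^+ 2] must stay below [tau * c];
   the 1 avoids a division by 0 when [K = 0] *)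
pose tau := c / (n%:R * K ^+ 2 + 1).
have nK1 : 0 < n%:R * K ^+ 2 + 1 by rewrite ltr_wpDl// mulr_ge0// sqr_ge0.
have tau0 : 0 < tau by rewrite divr_gt0.
have tauK : tau * (n%:R * K ^+ 2) <= c.
  by rewrite mulrAC ler_pdivrMr// ler_wpM2l ?(ltW c_gt0)// lerDl.
pose shift p i := p i - tau * F p i.
have [T TP] := choice (fun p => projection_exists (shift p) n_gt0).
have contr p q : distr p -> distr q ->
    sqdist (T p) (T q) <= sqdist p q - tau * c * l1 p q ^+ 2.
  move=> dp dq; apply: le_trans (projection_nonexpansive (TP p) (TP q)) _.
  have -> : sqdist (shift p) (shift q) = sqdist p q
      - 2 * tau * (\sum_i (F p i - F q i) * (p i - q i))
      + tau ^+ 2 * \sum_i (F p i - F q i) ^+ 2.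
    rewrite /sqdist !mulr_sumr -sumrB -big_split /=.
    by apply: eq_bigr => i _; rewrite /shift; ring.
  have FF : \sum_i (F p i - F q i) ^+ 2 <= n%:R * K ^+ 2 * l1 p q ^+ 2.
    apply: (@le_trans _ _ (\sum_(i < n) (K * l1 p q) ^+ 2)).
      apply: ler_sum => i _; rewrite -real_normK ?num_real//.
      have Kl : 0 <= K * l1 p q := le_trans (normr_ge0 _) (F_lip i dp dq).
      by rewrite lerXn2r ?nnegrE// F_lip.
    by rewrite sumr_const card_ord -[leLHS]mulr_natl exprMn mulrA.
  have H1 := ler_wpM2l (ltW tau0) (F_mono dp dq).
  have H2 := ler_wpM2l (sqr_ge0 tau) FF.
  have H3 := ler_wpM2r (sqr_ge0 (l1 p q)) (ler_wpM2l (ltW tau0) tauK).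
  nra.
have Tdist p q i : distr p -> distr q -> `|T p i - T q i| <= l1 p q.
  move=> dp dq.
  have : `|T p i - T q i| ^+ 2 <= l1 p q ^+ 2.
    apply: (@le_trans _ _ (sqdist (T p) (T q))).
      rewrite real_normK ?num_real// /sqdist (bigD1 i)//= lerDl.
      by apply: sumr_ge0 => j _; exact: sqr_ge0.
    apply: le_trans (contr p q dp dq) _.
    apply: (@le_trans _ _ (sqdist p q)).
      by rewrite gerBl mulr_ge0 ?sqr_ge0// mulr_ge0// ltW.
    rewrite /sqdist [leRHS]expr2 {1}/l1 mulr_suml; apply: ler_sum => j _.
    rewrite -real_normK ?num_real// expr2 ler_wpM2l//.
    by rewrite /l1 (bigD1 j)//= lerDl; apply: sumr_ge0.
  by rewrite ler_pXn2r ?nnegrE ?l1_ge0.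
have [||p dp pmin] := @simplex_argmin (fun p => sqdist p (T p)) (4 * n%:R) => //.
  move=> p q dp dq; rewrite /sqdist -sumrB.
  apply: le_trans (ler_norm_sum _ _ _) _.
  apply: (@le_trans _ _ (\sum_(i < n) (4 * l1 p q))); last first.
    by rewrite sumr_const card_ord -mulr_natr; lra.
  apply: ler_sum => i _.
  have B r : distr r -> `|r i - T r i| <= 1.
    move=> dr; have dTr := (TP r).1.
    have := distr_le1 i dr; have := distr_le1 i dTr.
    by have := dr.1 i; have := dTr.1 i; rewrite ler_norml; lra.
  apply: le_trans (sqr_lipschitz (B _ dp) (B _ dq)) _.
  have -> : p i - T p i - (q i - T q i) = (p i - q i) - (T p i - T q i) by ring.
  have := ler_normB (p i - q i) (T p i - T q i).
  have := Tdist p q i dp dq.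
  have : `|p i - q i| <= l1 p q.
    by rewrite /l1 (bigD1 i)//= lerDl; apply: sumr_ge0.
  lra.
have [dTp prTp] := TP p.
have pT : l1 p (T p) = 0.
  have := pmin (T p) dTp; have := contr p (T p) dp dTp => H1 H2.
  have : tau * c * l1 p (T p) ^+ 2 <= 0 by lra.
  rewrite (pmulr_rle0 _ (mulr_gt0 tau0 c_gt0)) => H; apply/eqP.
  by rewrite -sqrf_eq0 eq_le H sqr_ge0.
have Tpp i : T p i = p i.
  move/eqP: pT; rewrite psumr_eq0// => /allP/(_ i (mem_index_enum i)).
  by rewrite normr_eq0 subr_eq0 eq_sym => /eqP.
exists p => // q dq; have := prTp q dq.
have -> : \sum_i (shift p i - T p i) * (q i - T p i) =
          - (tau * \sum_i F p i * (q i - p i)).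
  rewrite mulr_sumr -sumrN; apply: eq_bigr => i _.
  by rewrite !Tpp /shift; ring.
by rewrite oppr_le0 pmulr_rge0.
Qed.

End VariationalInequality.

(** * Minimal masses *)

Section MinimalMass.
Variables (R : realType) (d n : nat) (X : 'I_n -> 'rV[R]_d).
Local Notation T := (borel R d).
Variables (P : probability T R) (S : set 'rV[R]_d).
Hypotheses (SX : S `<=` range X) (S0 : S !=set0).
Hypothesis P_gt0 : forall i, S (X i) -> 0 < masses X P i.

Lemma inf_mass_le i : S (X i) -> inf [set mass P x | x in S] <= masses X P i.
Proof.
move=> Si; apply: ge_inf; last by exists (X i).
by exists 0 => _ [x _ <-]; rewrite fine_ge0.
Qed.

Lemma inf_mass_gt0 : 0 < inf [set mass P x | x in S].
Proof.
have [x Sx] := S0; have [i0 _ xi] := SX Sx.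
have Pi0 : `[< S (X i0) >] by apply/asboolP; rewrite xi.
have := @arg_minP _ _ _ i0 (fun i => `[< S (X i) >]) (masses X P) Pi0.
case=> i /asboolP Si imin.
apply: lt_le_trans (P_gt0 Si) _; apply: lb_le_inf; first by exists (mass P x), x.
move=> _ [y Sy <-]; have [j _ jy] := SX Sy.
by rewrite -jy; apply: imin; apply/asboolP; rewrite jy.
Qed.

End MinimalMass.

(** * The mesh problem: well-posedness *)

Section Problem.
Variables (R : realType) (d : nat) (Omega : set 'rV[R]_d).
Hypotheses (Omega_compact : compact Omega).
Variable J : probability (borel R d) R -> 'rV[R]_d -> R.
Hypothesis J_continuous :
  forall mu, prob_on Omega mu -> {within Omega, continuous (J mu)}.
Variable L : R.
Hypothesis L_gt0 : 0 < L.
Hypothesis J_Lipschitz : forall mu nu, prob_on Omega mu -> prob_on Omega nu ->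
  sup_norm Omega (fun x => J mu x - J nu x) <= L * W1 mu nu.
Variable alpha : R.
Hypothesis alpha_gt0 : 0 < alpha.
Hypothesis J_monotone : forall rho sigma, prob_on Omega rho -> prob_on Omega sigma ->
  alpha * W1 rho sigma ^+ 2 <=
  pairing Omega (fun x => J rho x - J sigma x) rho sigma.
Variable N : nat.
Hypothesis N_ge2 : (2 <= N)%N.
Variable X : 'I_N -> 'rV[R]_d.
Hypotheses (X_injective : injective X) (X_Omega : forall i, Omega (X i)).

Local Notation T := (borel R d).
Local Notation masses := (masses X).
Implicit Types mu nu rho sigma : probability T R.
Let D := diam Omega.
Let delta := separation X.

Let Omega_closed : closed Omega.
Proof. by apply: compact_closed Omega_compact; exact: norm_hausdorff. Qed.

Let edist_le_D i j : edist (X i) (X j) <= D.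
Proof. exact: edist_le_diam. Qed.

Let delta_gt0 : 0 < delta.
Proof. exact: separation_gt0. Qed.

Let D_gt0 : 0 < D.
Proof.
case: N N_ge2 X X_injective edist_le_D => [|[|k]]// _ Y Yinj YD.
by apply: lt_le_trans (YD ord0 ord_max); apply: edist_gt0; apply/eqP => /Yinj.
Qed.

Lemma prob_on_Omega mu : prob_on (range X) mu -> prob_on Omega mu.
Proof. by apply: prob_on_sub => //; apply: closed_borel; exact: Omega_closed. Qed.

Lemma J_lip_masses mu nu i : prob_on (range X) mu -> prob_on (range X) nu ->
  `|J mu (X i) - J nu (X i)| <= L * (D / 2) * l1 (masses mu) (masses nu).
Proof.
move=> muX nuX; have muO := prob_on_Omega muX; have nuO := prob_on_Omega nuX.
apply: (@le_trans _ _ (L * W1 mu nu)); last first.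
  rewrite -mulrA ler_pM2l// mulrAC -mulrA.
  exact: (W1_le_l1 X_injective edist_le_D).
apply: le_trans (J_Lipschitz muO nuO).
apply: ub_le_sup; last by exists (X i).
have cont : {within Omega, continuous (fun x => J mu x - J nu x)}.
  by move=> x; apply: continuousB; exact: J_continuous.
have /compact_bounded[M [Mreal bM]] := continuous_compact cont Omega_compact.
exists (`|M| + 1) => _ [x Ox <-]; apply: bM; last by exists x.
by rewrite (le_lt_trans (ler_norm M))// ltrDl.
Qed.

Lemma J_mono_masses rho sigma : prob_on (range X) rho -> prob_on (range X) sigma ->
  alpha * W1 rho sigma ^+ 2 <=
  \sum_i (J rho (X i) - J sigma (X i)) * (masses rho i - masses sigma i).
Proof.
move=> rX sX; have rO := prob_on_Omega rX; have sO := prob_on_Omega sX.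
apply: le_trans (J_monotone rO sO) _.
rewrite (pairing_masses X_injective Omega_closed X_Omega rX sX)//.
by move=> x; apply: continuousB; exact: J_continuous.
Qed.

Lemma l1_le_W1_masses mu nu : prob_on (range X) mu -> prob_on (range X) nu ->
  delta * (l1 (masses mu) (masses nu) / 2) <= W1 mu nu.
Proof.
apply: (l1_le_W1 X_injective); first exact/ltW/delta_gt0.
by move=> i j; exact: separation_le.
Qed.

Lemma W1_nonneg mu nu : prob_on (range X) mu -> prob_on (range X) nu ->
  0 <= W1 mu nu.
Proof. exact: (W1_ge0 X_injective). Qed.

Lemma solves_VI_masses mus : prob_on (range X) mus ->
  solves_VI J X Omega mus <->
  (forall q, distr q -> 0 <= \sum_i J mus (X i) * (q i - masses mus i)).
Proof.
move=> mX; have mO := prob_on_Omega mX.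
split=> [[_ H] q dq|H].
  have [eta [eX eE]] := prob_with_masses X_injective dq.
  have := H eta eX; rewrite (pairing_masses X_injective Omega_closed)//.
    by rewrite eE.
  exact: J_continuous.
split=> // eta eX; rewrite (pairing_masses X_injective Omega_closed)//.
  by apply: H; exact: masses_distr.
exact: J_continuous.
Qed.

Lemma VI_exists : exists mus, solves_VI J X Omega mus.
Proof.
have /choice[M MP] : forall p : 'I_N -> R, exists mu,
    distr p -> prob_on (range X) mu /\ masses mu = p.
  move=> p; have [dp|ndp] := pselect (distr p); last by exists point.
  by have [mu] := prob_with_masses X_injective dp; exists mu.
have F_lip p q i : distr p -> distr q ->
    `|J (M p) (X i) - J (M q) (X i)| <= L * (D / 2) * l1 p q.
  move=> /MP[pX pE] /MP[qX qE]; rewrite -{2}pE -{2}qE; exact: J_lip_masses.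
have F_mono p q : distr p -> distr q -> alpha * (delta / 2) ^+ 2 * l1 p q ^+ 2 <=
    \sum_i (J (M p) (X i) - J (M q) (X i)) * (p i - q i).
  move=> /MP[pX pE] /MP[qX qE].
  have := J_mono_masses pX qX; rewrite pE qE; apply: le_trans.
  have := l1_le_W1_masses pX qX; rewrite pE qE => h.
  rewrite -mulrA ler_pM2l// -exprMn mulrAC -mulrA lerXn2r ?nnegrE ?W1_nonneg//.
  by rewrite mulr_ge0 ?divr_ge0 ?l1_ge0// ltW// delta_gt0.
have c0 : 0 < alpha * (delta / 2) ^+ 2.
  by rewrite mulr_gt0// exprn_gt0// divr_gt0// delta_gt0.
have [p dp sol] := VI_solution_exists (ltnW N_ge2) c0 F_lip F_mono.
have [pX pE] := MP p dp.
by exists (M p); apply/solves_VI_masses => // q dq; rewrite pE; exact: sol.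
Qed.

(** Adding the two inequalities gives [alpha * W1 mus mus' ^+ 2 <= 0], and [W1]
    separates mass vectors since the mesh points are apart. *)
Lemma VI_unique mus mus' : solves_VI J X Omega mus -> solves_VI J X Omega mus' ->
  same_measure mus mus'.
Proof.
move=> [mX H] [mX' H'].
have /(_ (masses mus') (masses_distr X_injective mX')) :=
  (solves_VI_masses mX).1 (conj mX H).
have /(_ (masses mus) (masses_distr X_injective mX)) :=
  (solves_VI_masses mX').1 (conj mX' H').
have := J_mono_masses mX mX'.
have -> : \sum_i (J mus (X i) - J mus' (X i)) * (masses mus i - masses mus' i) =
  - (\sum_i J mus (X i) * (masses mus' i - masses mus i)) -
  \sum_i J mus' (X i) * (masses mus i - masses mus' i).
  by rewrite -sumrN -sumrB; apply: eq_bigr => i _; ring.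
move=> W a b.
have W0 : W1 mus mus' = 0.
  apply/eqP; rewrite -sqrf_eq0 eq_le sqr_ge0 andbT -(pmulr_rle0 _ alpha_gt0).
  by lra.
have l0 : l1 (masses mus) (masses mus') = 0.
  have := l1_le_W1_masses mX mX'; rewrite W0 pmulr_rle0 ?delta_gt0// => h.
  by apply/eqP; rewrite eq_le l1_ge0 andbT; lra.
apply: (masses_same X_injective mX mX'); apply/funext => i.
apply/eqP; rewrite -subr_eq0 -normr_le0.
have := dist_le_half_l1 i (masses_distr X_injective mX) (masses_distr X_injective mX').
by rewrite l0; lra.
Qed.

(** * The Mirror-Prox iteration *)

Section Dynamics.
Variable lam : R.
Hypotheses (lam_gt0 : 0 < lam) (lam_lt : lam < 1 / (L * D)).
Variables (mus : probability T R) (mu nu : nat -> probability T R).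
Hypothesis mus_VI : solves_VI J X Omega mus.
Hypothesis iter : KL_mirror_prox J X lam mu nu.
Hypothesis mu0_supp : supp (mu 0%N) = range X.

Let q := masses mus.
Let p k := masses (mu k).
Let v k := masses (nu k).
Let gap k := kl q (p k).
Let theta := lam * L * D.

Let musX : prob_on (range X) mus. Proof. by case: mus_VI. Qed.
Let dq : distr q. Proof. exact: masses_distr. Qed.

Let theta_lt1 : theta < 1.
Proof.
have LD : 0 < L * D by rewrite mulr_gt0// D_gt0.
by move: lam_lt; rewrite ltr_pdivlMr// mulrA.
Qed.

Let theta_ge0 : 0 <= theta.
Proof. by rewrite !mulr_ge0// ltW// D_gt0. Qed.

Let muX k : prob_on (range X) (mu k).
Proof. by case: k => [|k]; [case: iter|case: iter => _ /(_ k)[_ []]]. Qed.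

Let nuX k : prob_on (range X) (nu k).
Proof. by case: iter => _ /(_ k)[[]]. Qed.

Let vE k : v k = gibbs_step lam (p k) (fun i => J (mu k) (X i)).
Proof. by apply/funext => i; case: iter => _ /(_ k)[[_ H] _]; exact: H. Qed.

Let pE k : p k.+1 = gibbs_step lam (p k) (fun i => J (nu k) (X i)).
Proof. by apply/funext => i; case: iter => _ /(_ k)[_ [_ H]]; exact: H. Qed.

Let dp k : distr (p k). Proof. exact/masses_distr/muX. Qed.
Let dv k : distr (v k). Proof. exact/masses_distr/nuX. Qed.

Let p_gt0 k i : 0 < p k i.
Proof.
elim: k i => [|k IH] i; last by rewrite pE; apply: gibbs_step_gt0 => //; exact: dp.
by apply/(masses_gt0_supp X_injective i (muX 0)); rewrite mu0_supp; exists i.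
Qed.

Lemma KL_gap k : KL mus (mu k) = (gap k)%:E.
Proof. exact: (KL_masses X_injective musX (muX k) (p_gt0 k)). Qed.

Lemma gap_ge0 k : 0 <= gap k.
Proof. exact: kl_ge0 dq (dp k) (p_gt0 k). Qed.

(** The gain of the correction step is evaluated at [nu k], where strong monotonicity
    and the variational inequality tested with [nu k] bound it below. *)
Lemma gap_decrease k :
  lam * alpha * W1 (nu k) mus ^+ 2 + (1 - theta) * kl (v k) (p k) <=
  gap k - gap k.+1.
Proof.
have D0 := D_gt0.
have K0 : 0 <= L * (D / 2) by rewrite mulr_ge0 ?divr_ge0// ltW.
have thE : lam * (L * (D / 2)) = theta / 2 by rewrite /theta; ring.
have gain : alpha * W1 (nu k) mus ^+ 2 <= \sum_i J (nu k) (X i) * (v k i - q i).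
  have mono := J_mono_masses (nuX k) musX.
  have := (solves_VI_masses musX).1 mus_VI (v k) (dv k).
  move: mono; rewrite -/q -/(v k).
  have -> : \sum_i (J (nu k) (X i) - J mus (X i)) * (v k i - q i) =
      \sum_i J (nu k) (X i) * (v k i - q i) - \sum_i J mus (X i) * (v k i - q i).
    by rewrite -sumrB; apply: eq_bigr => i _; ring.
  lra.
have lip i : `|J (mu k) (X i) - J (nu k) (X i)| <= L * (D / 2) * l1 (p k) (v k).
  exact: J_lip_masses (muX k) (nuX k).
have := theta_lt1; have := theta_ge0 => th0 th1.
have kl0 : 0 <= kl (v k) (p k) by exact: kl_ge0 (dv k) (dp k) (p_gt0 k).
have thle : lam * (L * (D / 2)) <= 1 by rewrite thE; lra.
rewrite /gap pE; rewrite vE in lip gain kl0 *.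
have := mirror_prox_energy (dp k) (p_gt0 k) dq (ltW lam_gt0) K0 lip thle gain.
by rewrite thE; nra.
Qed.

Let diff_ge0 : 0 <= 1 - theta. Proof. by rewrite subr_ge0 ltW// theta_lt1. Qed.

Let beta := 1 / 2 * Num.min (lam * alpha) ((1 - lam * L * D) / (2 * D ^+ 2)).
Let gamma := 1 / 4 * Num.min (lam * alpha * delta ^+ 2 / 2) (1 - lam * L * D).

Lemma beta_gt0 : 0 < beta.
Proof.
rewrite mulr_gt0// lt_min mulr_gt0//= divr_gt0//.
  by rewrite subr_gt0 theta_lt1.
by rewrite mulr_gt0// exprn_gt0// D_gt0.
Qed.

Lemma gamma_gt0 : 0 < gamma.
Proof.
rewrite mulr_gt0// lt_min subr_gt0 theta_lt1 andbT.
by rewrite divr_gt0// mulr_gt0// ?exprn_gt0 ?delta_gt0// mulr_gt0.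
Qed.

Lemma gamma_le : gamma <= 1 / 4.
Proof.
rewrite -[leRHS]mulr1 ler_wpM2l// ge_min; apply/orP; right.
by rewrite gerBl; exact: theta_ge0.
Qed.

(** Go from [mu k] to [nu k] at the price of [D] times their total variation, which
    the divergence of the prediction step pays for, and then from [nu k] to the solution. *)
Lemma gap_W1 k : beta * W1 (mu k) mus ^+ 2 <= gap k - gap k.+1.
Proof.
apply: le_trans (gap_decrease k).
set W := W1 (nu k) mus; set l := l1 (v k) (p k).
have D0 := D_gt0.
have W0 : 0 <= W1 (mu k) mus := W1_nonneg (muX k) musX.
have shift : W1 (mu k) mus <= W + D * (l / 2).
  by rewrite /l l1C; exact: (W1_shift X_injective edist_le_D (muX k) (nuX k) musX).
have := pinsker (dv k) (dp k) (p_gt0 k); rewrite -/l => pin.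
have sq : W1 (mu k) mus ^+ 2 <= 2 * W ^+ 2 + D ^+ 2 * l ^+ 2 / 2.
  apply: (@le_trans _ _ ((W + D * (l / 2)) ^+ 2)).
    by rewrite lerXn2r// nnegrE (le_trans W0).
  by have := sqr_ge0 (W - D * (l / 2)); lra.
have betaE : 2 * beta = Num.min (lam * alpha) ((1 - lam * L * D) / (2 * D ^+ 2)).
  by rewrite /beta; field.
have b1 : 2 * beta <= lam * alpha by rewrite betaE ge_min lexx.
have b2 : 2 * beta * D ^+ 2 <= (1 - theta) / 2.
  rewrite -ler_pdivlMr ?exprn_gt0// betaE ge_min; apply/orP; right.
  by rewrite -[leRHS]mulrA -invfM.
have H1 := ler_wpM2l (ltW beta_gt0) sq.
have H2 := ler_wpM2r (sqr_ge0 W) b1.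
have H3 := ler_wpM2r (sqr_ge0 l) b2.
have H4 := ler_wpM2l diff_ge0 pin.
have H5 : 0 <= (1 - theta) * l ^+ 2 by rewrite mulr_ge0// sqr_ge0.
lra.
Qed.

(** Same detour through [nu k], now measured in l1. *)
Lemma gap_l1 k : gamma * l1 q (p k) ^+ 2 <= gap k - gap k.+1.
Proof.
apply: le_trans (gap_decrease k).
set W := W1 (nu k) mus; set l := l1 (v k) (p k); set l' := l1 (v k) q.
have pin := pinsker (dv k) (dp k) (p_gt0 k); rewrite -/l in pin.
have tri : l1 q (p k) <= l' + l by rewrite /l' (l1C (v k)); exact: l1_triangle.
have sq : l1 q (p k) ^+ 2 <= 2 * l' ^+ 2 + 2 * l ^+ 2.
  apply: (@le_trans _ _ ((l' + l) ^+ 2)).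
    by rewrite lerXn2r// nnegrE ?addr_ge0 ?l1_ge0.
  by have := sqr_ge0 (l' - l); lra.
have Wl : delta ^+ 2 * l' ^+ 2 / 4 <= W ^+ 2.
  have -> : delta ^+ 2 * l' ^+ 2 / 4 = (delta * (l' / 2)) ^+ 2 by field.
  rewrite lerXn2r ?nnegrE ?(W1_nonneg (nuX k) musX)//.
    by rewrite mulr_ge0 ?divr_ge0 ?l1_ge0// ltW// delta_gt0.
  exact: l1_le_W1_masses (nuX k) musX.
have gammaE : 4 * gamma = Num.min (lam * alpha * delta ^+ 2 / 2) (1 - lam * L * D).
  by rewrite /gamma; field.
have g1 : 4 * gamma <= lam * alpha * delta ^+ 2 / 2 by rewrite gammaE ge_min lexx.
have g2 : 4 * gamma <= 1 - theta by rewrite gammaE ge_min lexx orbT.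
have H1 := ler_wpM2l (ltW gamma_gt0) sq.
have H2 := ler_wpM2r (sqr_ge0 l') g1.
have H3 := ler_wpM2r (sqr_ge0 l) g2.
have H4 := ler_wpM2l diff_ge0 pin.
have H5 := ler_wpM2l (ltW (mulr_gt0 lam_gt0 alpha_gt0)) Wl.
have H6 : 0 <= (1 - theta) * l ^+ 2 by rewrite mulr_ge0// sqr_ge0.
lra.
Qed.

Lemma gap_noninc k j : (k <= j)%N -> gap j <= gap k.
Proof.
move=> /subnKC <-; elim: (j - k)%N => [|i IH]; first by rewrite addn0.
rewrite addnS; apply: le_trans IH; rewrite -subr_ge0.
by apply: le_trans (gap_l1 _); rewrite mulr_ge0 ?sqr_ge0// ltW// gamma_gt0.
Qed.

Lemma l1_gap k : l1 q (p k) ^+ 2 <= 2 * gap k.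
Proof. exact: pinsker dq (dp k) (p_gt0 k). Qed.

Lemma W1_le_sqrt k B : gap k <= B -> W1 (mu k) mus <= D / 2 * Num.sqrt (2 * B).
Proof.
move=> gB; have D0 := D_gt0.
apply: le_trans (W1_le_l1 X_injective edist_le_D (muX k) musX) _.
rewrite mulrCA mulrC ler_wpM2l ?divr_ge0 ?(ltW D0)//.
rewrite -[leLHS]ger0_norm ?l1_ge0// -sqrtr_sqr ler_wsqrtr// l1C.
by apply: le_trans (l1_gap k) _; rewrite ler_pM2l.
Qed.

Let m := inf [set mass mus x | x in supp mus].

Let supp_q i : supp mus (X i) <-> 0 < q i.
Proof. exact: masses_gt0_supp. Qed.

Lemma supp_neq0 : supp mus !=set0.
Proof.
have [i qi] : exists i, q i != 0.
  apply: contrapT => none; have := dq.2; rewrite big1 => [/esym/eqP|i _].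
    by rewrite oner_eq0.
  by apply: contrapT => /eqP qi; apply: none; exists i.
exists (X i); apply/supp_q; rewrite lt_neqAle eq_sym qi; exact: dq.1.
Qed.

Lemma m_le i : 0 < q i -> m <= q i.
Proof. by move=> /supp_q; exact: inf_mass_le. Qed.

Lemma m_gt0 : 0 < m.
Proof.
apply: (inf_mass_gt0 (supp_sub_range musX) supp_neq0).
by move=> i /supp_q.
Qed.

Lemma m_le1 : m <= 1.
Proof.
have [x sx] := supp_neq0; have [i _ xi] := supp_sub_range musX sx.
apply: le_trans (distr_le1 i dq); apply: m_le; apply/supp_q.
by rewrite xi.
Qed.

Lemma near_close k : gap k <= m ^+ 2 / 8 -> l1 q (p k) <= m / 2.
Proof.
move=> g; rewrite -(@ler_pXn2r _ 2)// ?nnegrE ?l1_ge0//.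
  by have := l1_gap k; lra.
by rewrite divr_ge0// ltW// m_gt0.
Qed.

Lemma near_gap_le_l1 k : l1 q (p k) <= m / 2 -> gap k <= 2 * l1 q (p k).
Proof.
by move=> c; apply: (kl_le_l1 m_gt0 dq (dp k) (p_gt0 k) c) => i; exact: m_le.
Qed.

Lemma gap_quadratic k : l1 q (p k) <= m / 2 ->
  gamma / 4 * gap k ^+ 2 <= gap k - gap k.+1.
Proof.
move=> c; apply: le_trans (gap_l1 k).
rewrite -mulrA ler_pM2l ?gamma_gt0//.
have : gap k ^+ 2 <= (2 * l1 q (p k)) ^+ 2.
  rewrite lerXn2r ?nnegrE ?gap_ge0 ?mulr_ge0 ?l1_ge0//.
  exact: near_gap_le_l1.
lra.
Qed.

(** Far from the solution, either the l1 distance exceeds [m / 2], or it is still at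
    least half of the gap, which exceeds [m ^+ 2 / 8]; both cases yield the decrease
    [gamma * m ^+ 4 / 256]. *)
Lemma sublinear_phase : exists2 k0 : nat,
  k0%:Z <= Num.ceil (256 * gap 0%N / (gamma * m ^+ 4)) &
  forall k, (k0 <= k)%N ->
    gap k <= 1 / (8 / m ^+ 2 + gamma / 4 * (k - k0)%:R).
Proof.
have m0 := m_gt0; have g0 := gamma_gt0.
have m1 := m_le1.
have step k : m ^+ 2 / 8 < gap k -> gamma * m ^+ 4 / 256 <= gap k - gap k.+1.
  move=> far; have [c|c] := lerP (l1 q (p k)) (m / 2).
    apply: le_trans (gap_quadratic c).
    have : (m ^+ 2 / 8) ^+ 2 <= gap k ^+ 2.
      by rewrite lerXn2r ?nnegrE ?gap_ge0 ?divr_ge0 ?sqr_ge0// ltW.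
    move=> /(ler_wpM2l (ltW g0)).
    by lra.
  apply: le_trans (gap_l1 k); rewrite -mulrA ler_pM2l//.
  have : (m / 2) ^+ 2 <= l1 q (p k) ^+ 2.
    by rewrite lerXn2r ?nnegrE ?l1_ge0 ?divr_ge0 ?(ltW m0)// ltW.
  have : m ^+ 4 <= m ^+ 2 by rewrite ler_wiXn2l// ltW.
  by have := sqr_ge0 m; lra.
have c0 : 0 < gamma * m ^+ 4 / 256 by rewrite divr_gt0// mulr_gt0// exprn_gt0.
have b0 : 0 <= m ^+ 2 / 8 by rewrite divr_ge0// sqr_ge0.
have [k0 k0le gk0] := first_passage gap_ge0 b0 c0 step.
exists k0.
  have -> // : 256 * gap 0%N / (gamma * m ^+ 4) = gap 0%N / (gamma * m ^+ 4 / 256).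
  by field; rewrite !gt_eqF// exprn_gt0.
apply: sublinear_rate => //.
- by rewrite divr_gt0// exprn_gt0.
- by rewrite divr_ge0// ltW.
- exact: gap_ge0.
- by rewrite div1r invf_div.
- move=> k k0k; apply: gap_quadratic; apply: near_close.
  exact: le_trans (gap_noninc k0k) gk0.
Qed.

(** As in [sublinear_phase], with the quadratic comparison of entropy and l1 distance
    in place of the linear one. *)
Lemma linear_phase : (forall i, 0 < q i) -> exists2 k0 : nat,
  k0%:Z <= Num.ceil (8 * gap 0%N / (gamma * m ^+ 3)) &
  forall k, (k0 <= k)%N ->
    gap k <= m ^+ 2 / 8 * (1 - gamma * m) ^+ (k - k0).
Proof.
move=> qpos; have m0 := m_gt0; have g0 := gamma_gt0; have m1 := m_le1.
have near k : l1 q (p k) <= m / 2 -> m * gap k <= l1 q (p k) ^+ 2.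
  by move=> c; apply: (kl_le_l1_sqr m0 dq (dp k) (p_gt0 k) c) => i; exact: m_le.
have step k : m ^+ 2 / 8 < gap k -> gamma * m ^+ 3 / 8 <= gap k - gap k.+1.
  move=> far; apply: le_trans (gap_l1 k); rewrite -mulrA ler_pM2l//.
  have [c|c] := lerP (l1 q (p k)) (m / 2).
    by apply: le_trans (near k c); rewrite exprS -mulrA ler_pM2l// ltW.
  have : (m / 2) ^+ 2 <= l1 q (p k) ^+ 2.
    by rewrite lerXn2r ?nnegrE ?l1_ge0 ?divr_ge0 ?(ltW m0)// ltW.
  have : m ^+ 3 <= m ^+ 2 by rewrite ler_wiXn2l// ltW.
  by have := sqr_ge0 m; lra.
have c0 : 0 < gamma * m ^+ 3 / 8 by rewrite divr_gt0// mulr_gt0// exprn_gt0.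
have b0 : 0 <= m ^+ 2 / 8 by rewrite divr_ge0// sqr_ge0.
have [k0 k0le gk0] := first_passage gap_ge0 b0 c0 step.
exists k0.
  have -> // : 8 * gap 0%N / (gamma * m ^+ 3) = gap 0%N / (gamma * m ^+ 3 / 8).
  by field; rewrite !gt_eqF// exprn_gt0.
apply: linear_rate => //.
  by rewrite subr_ge0; have := gamma_le; nra.
move=> k k0k.
have := near k (near_close (le_trans (gap_noninc k0k) gk0)).
move=> /(ler_wpM2l (ltW g0)); have := gap_l1 k; lra.
Qed.

Lemma gap_small (eta : R) : 0 < eta ->
  exists k0 : nat, forall k, (k0 <= k)%N -> gap k <= eta.
Proof.
move=> e0; have g0 := gamma_gt0; have m0 := m_gt0.
have [k0 _ rate] := sublinear_phase.
pose j := `|Num.ceil (4 / (gamma * eta))|%N.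
exists (k0 + j)%N => k kk.
have k0k : (k0 <= k)%N := leq_trans (leq_addr _ _) kk.
apply: le_trans (rate k k0k) _.
have big : 4 / (gamma * eta) <= (k - k0)%:R.
  apply: (@le_trans _ _ (j%:R)); last first.
    by rewrite ler_nat -(leq_add2l k0) subnKC.
  rewrite (le_trans (ceil_ge _))// /j natr_absz ler_int ler_norm//.
have den : 1 / eta <= 8 / m ^+ 2 + gamma / 4 * (k - k0)%:R.
  have -> : 1 / eta = gamma / 4 * (4 / (gamma * eta)).
    by field; rewrite !gt_eqF.
  rewrite (le_trans (ler_wpM2l _ big)) ?divr_ge0 ?(ltW g0)//.
  by rewrite lerDr divr_ge0// sqr_ge0.
rewrite ler_pdivrMr; last by rewrite (lt_le_trans _ den)// divr_gt0.
by rewrite -ler_pdivrMl// mulrC.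
Qed.

Let cvg_of_sqr (w : nat -> R) (c : R) : 0 < c -> (forall k, 0 <= w k) ->
  (forall k, c * w k ^+ 2 <= gap k) -> w @ \oo --> 0.
Proof.
move=> c0 w0 wg; apply/cvgrPdist_le => e e0.
have ce : 0 < c * e ^+ 2 by rewrite mulr_gt0// exprn_gt0.
have [k0 H] := gap_small ce.
exists k0 => // k /= kk; rewrite sub0r normrN ger0_norm//.
rewrite -(@ler_pXn2r _ 2)// ?nnegrE ?(ltW e0)// -(ler_pM2l c0).
exact: le_trans (wg k) (H k kk).
Qed.

Lemma mu_cvg : (fun k => W1 (mu k) mus) @ \oo --> 0.
Proof.
apply: (cvg_of_sqr beta_gt0) => k; first exact: W1_nonneg (muX k) musX.
by have := gap_W1 k; have := gap_ge0 k.+1; lra.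
Qed.

Lemma nu_cvg : (fun k => W1 (nu k) mus) @ \oo --> 0.
Proof.
apply: (cvg_of_sqr (mulr_gt0 lam_gt0 alpha_gt0)) => k.
  exact: W1_nonneg (nuX k) musX.
have := gap_decrease k; have := gap_ge0 k.+1.
have : 0 <= (1 - theta) * kl (v k) (p k).
  by rewrite mulr_ge0//; exact: kl_ge0 (dv k) (dp k) (p_gt0 k).
lra.
Qed.

Let supp_sub : supp mus `<=` range X. Proof. exact: supp_sub_range. Qed.

Lemma gap0_le : gap 0%N <= - ln (inf [set mass (mu 0%N) x | x in supp mus]).
Proof.
set M := inf _.
have M0 : 0 < M.
  by apply: (inf_mass_gt0 supp_sub supp_neq0) => i _; exact: p_gt0.
have -> : - ln M = \sum_i q i * (- ln M) by rewrite -mulr_suml dq.2 mul1r.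
apply: ler_sum => i _.
have [->|qi] := eqVneq (q i) 0; first by rewrite !mul0r.
have {}qi : 0 < q i by rewrite lt_neqAle eq_sym qi; exact: dq.1.
rewrite ler_pM2l// ln_div ?posrE ?p_gt0//.
have Mp : M <= p 0%N i by apply: inf_mass_le; apply/supp_q.
have : ln M <= ln (p 0%N i) by rewrite ler_ln ?posrE ?p_gt0.
have : ln (q i) <= 0 by apply: ln_le0; exact: distr_le1.
lra.
Qed.

Lemma inf_supp_range :
  - ln (inf [set mass (mu 0%N) x | x in supp mus]) <=
  - ln (inf [set mass (mu 0%N) x | x in range X]).
Proof.
have pos S : S `<=` range X -> S !=set0 -> 0 < inf [set mass (mu 0%N) x | x in S].
  by move=> SX S0; apply: inf_mass_gt0 SX S0 _ => i _; exact: p_gt0.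
have [x sx] := supp_neq0.
rewrite lerN2 ler_ln ?posrE ?pos//; last 2 first.
- by exists x; exact: supp_sub.
- by exists x.
apply: lb_le_inf; first by exists (mass (mu 0%N) x), x.
move=> _ [y sy <-]; apply: ge_inf; last by exists y => //; exact: supp_sub.
by exists 0 => _ [z _ <-]; rewrite fine_ge0.
Qed.

Lemma KL_decrease k :
  ((beta * W1 (mu k) mus ^+ 2)%:E <= KL mus (mu k) - KL mus (mu k.+1))%E.
Proof. by rewrite !KL_gap -EFinB lee_fin gap_W1. Qed.

Lemma KL_sublinear_rate : exists k0 : nat,
  k0%:Z <= Num.ceil (256 * fine (KL mus (mu 0%N)) / (gamma * m ^+ 4)) /\
  forall k, (k0 <= k)%N ->
    (KL mus (mu k) <= (1 / (8 / m ^+ 2 + gamma / 4 * (k - k0)%:R))%:E)%E /\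
    W1 (mu k) mus <= D * Num.sqrt (2 / (8 / m ^+ 2 + gamma / 4 * (k - k0)%:R)).
Proof.
have [k0 k0le rate] := sublinear_phase.
exists k0; rewrite KL_gap; split=> // k k0k; rewrite KL_gap lee_fin.
have gk := rate k k0k; split=> //.
apply: le_trans (W1_le_sqrt gk) _.
rewrite mul1r ler_wpM2r ?sqrtr_ge0//.
by rewrite ler_pdivrMr// ler_peMr ?ler1n// ltW// D_gt0.
Qed.

Lemma KL_linear_rate : supp mus = range X -> exists k0 : nat,
  k0%:Z <= Num.ceil (8 * fine (KL mus (mu 0%N)) / (gamma * m ^+ 3)) /\
  forall k, (k0 <= k)%N ->
    (KL mus (mu k) <= (m ^+ 2 / 8 * (1 - gamma * m) ^+ (k - k0))%:E)%E /\
    W1 (mu k) mus <= D * (m / 2) * (1 - gamma * m) `^ ((k - k0)%:R / 2).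
Proof.
move=> full; have D0 := D_gt0; have m0 := m_gt0.
have qpos i : 0 < q i by apply/supp_q; rewrite full; exists i.
have r0 : 0 <= 1 - gamma * m.
  by rewrite subr_ge0; have := gamma_le; have := m_le1; have := gamma_gt0; nra.
have [k0 k0le rate] := linear_phase qpos.
exists k0; rewrite KL_gap; split=> // k k0k; rewrite KL_gap lee_fin.
have gk := rate k k0k; split=> //.
apply: le_trans (W1_le_sqrt gk) _.
have -> : (1 - gamma * m) `^ ((k - k0)%:R / 2) = Num.sqrt ((1 - gamma * m) ^+ (k - k0)).
  by rewrite powRrM powR_mulrn// powR12_sqrt// exprn_ge0.
have -> : 2 * (m ^+ 2 / 8 * (1 - gamma * m) ^+ (k - k0)) =
    (m / 2) ^+ 2 * (1 - gamma * m) ^+ (k - k0) by field.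
rewrite sqrtrM ?sqr_ge0// sqrtr_sqr ger0_norm ?divr_ge0 ?(ltW m0)//.
rewrite mulrA ler_wpM2r ?sqrtr_ge0// ler_wpM2r ?divr_ge0 ?(ltW m0)//.
by rewrite ler_pdivrMr// ler_peMr ?ler1n// ltW.
Qed.

Lemma KL0_le :
  (KL mus (mu 0%N) <= (- ln (inf [set mass (mu 0%N) x | x in supp mus]))%:E)%E.
Proof. by rewrite KL_gap lee_fin gap0_le. Qed.

End Dynamics.
End Problem.

Theorem theorem4p1 (R : realType) (d : nat) (Omega : set 'rV[R]_d)
    (Omega_neq0 : Omega !=set0) (Omega_compact : compact Omega)
    (J : probability (borel R d) R -> 'rV[R]_d -> R)
    (J_continuous : forall mu, prob_on Omega mu -> {within Omega, continuous (J mu)})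
    (L : R) (L_gt0 : 0 < L)
    (J_Lipschitz : forall mu nu, prob_on Omega mu -> prob_on Omega nu ->
       sup_norm Omega (fun x => J mu x - J nu x) <= L * W1 mu nu)
    (alpha : R) (alpha_gt0 : 0 < alpha)
    (J_monotone : forall rho sigma, prob_on Omega rho -> prob_on Omega sigma ->
       alpha * W1 rho sigma ^+ 2 <=
       pairing Omega (fun x => J rho x - J sigma x) rho sigma)
    (N : nat) (N_ge2 : (2 <= N)%N) (X : 'I_N -> 'rV[R]_d)
    (X_injective : injective X) (X_Omega : forall i, Omega (X i))
    (lam : R) (lam_gt0 : 0 < lam) (lam_lt : lam < 1 / (L * diam Omega)) :
  (exists mus, solves_VI J X Omega mus) /\
  (forall mus mus', solves_VI J X Omega mus -> solves_VI J X Omega mus' ->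
     same_measure mus mus') /\
  forall (mus : probability (borel R d) R) (mu nu : nat -> probability (borel R d) R),
  solves_VI J X Omega mus ->
  KL_mirror_prox J X lam mu nu ->
  supp (mu 0%N) = range X ->
  let D k := KL mus (mu k) in
  let diamO := diam Omega in
  let m := inf [set mass mus x | x in supp mus] in
  let beta := 1 / 2 *
    Num.min (lam * alpha) ((1 - lam * L * diamO) / (2 * diamO ^+ 2)) in
  let gamma := 1 / 4 *
    Num.min (lam * alpha * separation X ^+ 2 / 2) (1 - lam * L * diamO) in
  ((fun k => W1 (mu k) mus) @ \oo --> 0) /\
  ((fun k => W1 (nu k) mus) @ \oo --> 0) /\
  (forall k, ((beta * W1 (mu k) mus ^+ 2)%:E <= D k - D k.+1)%E) /\
  (exists k0 : nat,
     k0%:Z <= Num.ceil (256 * fine (D 0%N) / (gamma * m ^+ 4)) /\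
     forall k, (k0 <= k)%N ->
       (D k <= (1 / (8 / m ^+ 2 + gamma / 4 * (k - k0)%:R))%:E)%E /\
       W1 (mu k) mus <=
         diamO * Num.sqrt (2 / (8 / m ^+ 2 + gamma / 4 * (k - k0)%:R))) /\
  (supp mus = range X ->
   exists k0 : nat,
     k0%:Z <= Num.ceil (8 * fine (D 0%N) / (gamma * m ^+ 3)) /\
     forall k, (k0 <= k)%N ->
       (D k <= (m ^+ 2 / 8 * (1 - gamma * m) ^+ (k - k0))%:E)%E /\
       W1 (mu k) mus <=
         diamO * (m / 2) * (1 - gamma * m) `^ ((k - k0)%:R / 2)) /\
  (D 0%N <= (- ln (inf [set mass (mu 0%N) x | x in supp mus]))%:E)%E /\
  - ln (inf [set mass (mu 0%N) x | x in supp mus]) <=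
    - ln (inf [set mass (mu 0%N) x | x in range X]).
Proof.
split.
  exact: (VI_exists Omega_compact J_continuous L_gt0 J_Lipschitz alpha_gt0
            J_monotone N_ge2 X_injective X_Omega).
split.
  exact: (VI_unique Omega_compact J_continuous alpha_gt0 J_monotone N_ge2
            X_injective X_Omega).
move=> mus mu nu solves iter supp0 D diamO m beta gamma.
split.
  exact: (mu_cvg Omega_compact J_continuous L_gt0 J_Lipschitz alpha_gt0 J_monotone
            N_ge2 X_injective X_Omega lam_gt0 lam_lt solves iter supp0).
split.
  exact: (nu_cvg Omega_compact J_continuous L_gt0 J_Lipschitz alpha_gt0 J_monotone
            N_ge2 X_injective X_Omega lam_gt0 lam_lt solves iter supp0).
split.
  exact: (KL_decrease Omega_compact J_continuous L_gt0 J_Lipschitz alpha_gt0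
            J_monotone N_ge2 X_injective X_Omega lam_gt0 lam_lt solves iter supp0).
split.
  exact: (KL_sublinear_rate Omega_compact J_continuous L_gt0 J_Lipschitz alpha_gt0
            J_monotone N_ge2 X_injective X_Omega lam_gt0 lam_lt solves iter supp0).
split.
  exact: (KL_linear_rate Omega_compact J_continuous L_gt0 J_Lipschitz alpha_gt0
            J_monotone N_ge2 X_injective X_Omega lam_gt0 lam_lt solves iter supp0).
split.
  exact: (KL0_le X_injective solves iter supp0).
exact: (inf_supp_range X_injective solves iter supp0).
Qed.
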